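(* Let $G$ be a non-discrete locally compact second countable group and $E\subseteq G$ be a closed countable set. Then $E$ is a $U$-set.
   Context: $\lambda$ is the left regular representation of $G$ on $L^2(G)$; $C_r^*(G)$ is the norm closure of $\lambda(L^1(G))$ and $\mathrm{VN}(G)$ its weak* closure. $A(G)$ is the Fourier algebra, identified with the predual of $\mathrm{VN}(G)$ via $\langle T,u\rangle=(T\xi,\eta)$ for $u(s)=(\lambda_s\xi,\eta)$. For closed $E\subseteq G$, $J(E)$ is the norm closure in $A(G)$ of the set of functions in $A(G)$ vanishing on a neighbourhood of $E$, and $J(E)^\perp\subseteq\mathrm{VN}(G)$ its annihilator. $E$ is a $U$-set if $J(E)^\perp\cap C_r^*(G)=\{0\}$. *)

(* Defs.v *)
From HB Require Import structures.
From mathcomp Require Import all_boot all_order all_algebra.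
From mathcomp Require Import complex.
From mathcomp Require Import all_classical all_reals all_analysis.
From mathcomp Require Import measurable_realfun.

Set Implicit Arguments.
Unset Strict Implicit.
Unset Printing Implicit Defensive.

Import Order.TTheory GRing.Theory Num.Def Num.Theory.
Import numFieldNormedType.Exports.

Local Open Scope classical_set_scope.
Local Open Scope ring_scope.
Local Open Scope complex_scope.
Local Open Scope quotient_scope.

Section complex_Lp.
Context d (T : measurableType d) (R : realType) (mu : {measure set T -> \bar R}).

(* The library's Lp-functions are real-valued; a complex function is in L^p
   iff its real and imaginary parts are. *)
Definition cLfun (p : \bar R) : {pred T -> R[i]} :=
  [pred f : T -> R[i] | ((fun x => complex.Re (f x)) \in Lfun mu p)
                     && ((fun x => complex.Im (f x)) \in Lfun mu p)].

Definition cintegral (f : T -> R[i]) : R[i] :=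
  (\int[mu]_x complex.Re (f x)) +i* (\int[mu]_x complex.Im (f x)).

Let ReZD (a x y : R[i]) : complex.Re (a * x + y) =
  complex.Re a * complex.Re x + (- complex.Im a * complex.Im x + complex.Re y).
Proof. by case: a x y => [? ?] [? ?] [? ?]/=; rewrite mulNr addrA. Qed.

Let ImZD (a x y : R[i]) : complex.Im (a * x + y) =
  complex.Re a * complex.Im x + (complex.Im a * complex.Re x + complex.Im y).
Proof. by case: a x y => [? ?] [? ?] [? ?]/=; rewrite addrA. Qed.

Lemma cLfun_submod_closed p : (1 <= p)%E -> submod_closed (cLfun p).
Proof.
move=> p1; have [L0 LZD] := @Lfun_submod_closed _ T R mu p p1.
split; first by apply/andP; split; exact: L0.
move=> a f g /andP[fr fi] /andP[gr gi]; apply/andP; split.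
- have -> : (fun x => complex.Re ((a *: f + g) x)) =
    complex.Re a *: (fun x => complex.Re (f x)) +
    (- complex.Im a *: (fun x => complex.Im (f x)) + (fun x => complex.Re (g x))).
    by apply/funext => x; exact: ReZD.
  by apply: (LZD) => //; apply: (LZD).
- have -> : (fun x => complex.Im ((a *: f + g) x)) =
    complex.Re a *: (fun x => complex.Im (f x)) +
    (complex.Im a *: (fun x => complex.Re (f x)) + (fun x => complex.Im (g x))).
    by apply/funext => x; exact: ImZD.
  by apply: (LZD) => //; apply: (LZD).
Qed.

HB.instance Definition _ := GRing.isSubmodClosed.Build R[i] (T -> R[i])
  (cLfun 2%:E) (cLfun_submod_closed (lee1n 2)).

Record sqintegrable := SqIntegrable {
  sqfun :> T -> R[i] ;
  sqfunP : sqfun \in cLfun 2%:E }.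

HB.instance Definition _ := [isSub for sqfun].
HB.instance Definition _ := [Choice of sqintegrable by <:].
HB.instance Definition _ := [SubChoice_isSubLmodule of sqintegrable by <:].

Lemma sqfunD (f g : sqintegrable) x : (f + g) x = f x + g x.
Proof. by []. Qed.

Lemma sqfunN (f : sqintegrable) x : (- f) x = - f x.
Proof. by []. Qed.

Lemma sqfunZ a (f : sqintegrable) x : (a *: f) x = a * f x.
Proof. by []. Qed.

Definition sqnull : {pred sqintegrable} :=
  fun f => `[< \forall x \ae mu, f x = 0 >].

Lemma sqnull_submod_closed : submod_closed sqnull.
Proof.
split; first by apply/asboolP; exact: aeW.
move=> a f g /asboolP f0 /asboolP g0; apply/asboolP.
by apply: filterS2 f0 g0 => x fx gx; rewrite sqfunD sqfunZ fx gx mulr0 addr0.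
Qed.

HB.instance Definition _ := GRing.isSubmodClosed.Build R[i] sqintegrable
  sqnull sqnull_submod_closed.

(* The library's [LspaceType] is real and carries no vector space structure,
   so L^2(T, mu; C) is built here as a quotient by the a.e. null functions. *)
Definition cL2 := Quotient.quot sqnull.

HB.instance Definition _ := EqQuotient.on cL2.
HB.instance Definition _ := ZmodQuotient.on cL2.

Lemma cL2P (f g : sqintegrable) :
  \pi_cL2 f = \pi_cL2 g <-> \forall x \ae mu, f x = g x.
Proof.
split=> [/eqP|fg].
  rewrite -Quotient.idealrBE => /asboolP.
  by apply: filterS => x /eqP; rewrite sqfunD sqfunN subr_eq0 => /eqP.
apply/eqP; rewrite -Quotient.idealrBE; apply/asboolP.
by apply: filterS fg => x fg; rewrite sqfunD sqfunN fg subrr.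
Qed.

Lemma cL2_reprP (f : sqintegrable) : \forall x \ae mu, repr (\pi_cL2 f) x = f x.
Proof. by apply/cL2P; rewrite reprK. Qed.

Definition cL2_scale (a : R[i]) (u : cL2) : cL2 := \pi_cL2 (a *: repr u).

Lemma cL2_scaleE a f : cL2_scale a (\pi_cL2 f) = \pi_cL2 (a *: f).
Proof. by apply/cL2P; apply: filterS (cL2_reprP f) => x fx; rewrite !sqfunZ fx. Qed.

Let cL2_scaleA a b u : cL2_scale a (cL2_scale b u) = cL2_scale (a * b) u.
Proof. by elim/quotW: u => f; rewrite (cL2_scaleE b) !cL2_scaleE scalerA. Qed.

Let cL2_scale1 : left_id 1 cL2_scale.
Proof. by elim/quotW => f; rewrite cL2_scaleE scale1r. Qed.

Let cL2_scaleDr : right_distributive cL2_scale +%R.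
Proof.
move=> a; elim/quotW => f; elim/quotW => g.
by rewrite -pi_addr !cL2_scaleE -pi_addr scalerDr.
Qed.

Let cL2_scaleDl u : {morph cL2_scale^~ u : a b / a + b}.
Proof.
by elim/quotW: u => f a b; rewrite !cL2_scaleE -pi_addr scalerDl.
Qed.

HB.instance Definition _ := GRing.Zmodule_isLmodule.Build R[i] cL2
  cL2_scaleA cL2_scale1 cL2_scaleDr cL2_scaleDl.

Lemma cL2_piZ a f : a *: \pi_cL2 f = \pi_cL2 (a *: f).
Proof. exact: cL2_scaleE. Qed.

Lemma cintegralZD a f g : f \in cLfun 1 -> g \in cLfun 1 ->
  cintegral (fun x => a * f x + g x) = a * cintegral f + cintegral g.
Proof.
move=> /andP[/Lfun1_integrable fr /Lfun1_integrable fi].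
move=> /andP[/Lfun1_integrable gr /Lfun1_integrable gi].
have RID k l (u v w : T -> R) : mu.-integrable setT (EFin \o u) ->
    mu.-integrable setT (EFin \o v) -> mu.-integrable setT (EFin \o w) ->
    \int[mu]_x (k * u x + (l * v x + w x)) =
    k * (\int[mu]_x u x) + (l * (\int[mu]_x v x) + \int[mu]_x w x).
  move=> iu iv iw.
  have iZ c (h : T -> R) : mu.-integrable setT (EFin \o h) ->
      mu.-integrable setT (EFin \o (fun x => c * h x)).
    move=> ih; rewrite [X in mu.-integrable _ X](_ : _ =
      (fun x => c%:E * (h x)%:E)%E)//.
    exact: integrableZl.
  rewrite RintegralD//; first last.
  - rewrite [X in mu.-integrable _ X](_ : _ =
      (fun x => (l * v x)%:E + (w x)%:E)%E)//.
    by apply: integrableD => //; exact: (iZ).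
  - exact: iZ.
  rewrite RintegralD//; last exact: iZ.
  by rewrite !RintegralZl.
apply/eqP; rewrite eq_complex; apply/andP; split; apply/eqP.
- by rewrite ReZD /=; under eq_Rintegral do rewrite ReZD; exact: RID.
- by rewrite ImZD /=; under eq_Rintegral do rewrite ImZD; exact: RID.
Qed.

Lemma eq_cintegral_ae f g : f \in cLfun 1 -> g \in cLfun 1 ->
  (\forall x \ae mu, f x = g x) -> cintegral f = cintegral g.
Proof.
move=> /andP[/Lfun1_integrable fr /Lfun1_integrable fi].
move=> /andP[/Lfun1_integrable gr /Lfun1_integrable gi] fg.
rewrite /cintegral /Rintegral; congr (fine _ +i* fine _);
  apply: ae_eq_integral => //; try exact: (measurable_int mu).
- by apply: filterS fg => x fgx _; rewrite fgx.
- by apply: filterS fg => x fgx _; rewrite fgx.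
Qed.

Lemma cintegralJ f : f \in cLfun 1 ->
  cintegral (fun x => (f x)^*%C) = (cintegral f)^*%C.
Proof.
move=> /andP[fr /Lfun1_integrable fi].
rewrite /cintegral /=; congr (_ +i* _).
  by apply: eq_Rintegral => x _; case: (f x).
rewrite -[in RHS]mulN1r -RintegralZl//.
by apply: eq_Rintegral => x _; rewrite mulN1r; case: (f x).
Qed.

Lemma cLfun2_mulJ (f g : T -> R[i]) : f \in cLfun 2%:E -> g \in cLfun 2%:E ->
  (fun x => f x * (g x)^*%C) \in cLfun 1.
Proof.
move=> /andP[fr fi] /andP[gr gi].
have [_ LZD] := @Lfun_submod_closed _ T R mu _ (lexx 1%E).
apply/andP; split.
- have -> : (fun x => complex.Re (f x * (g x)^*%C)) =
    1 *: ((fun x => complex.Re (f x)) \* (fun x => complex.Re (g x))) +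
    ((fun x => complex.Im (f x)) \* (fun x => complex.Im (g x))).
    apply/funext => x; rewrite scale1r.
    change (complex.Re (f x * (g x)^*%C) =
      complex.Re (f x) * complex.Re (g x) + complex.Im (f x) * complex.Im (g x)).
    by case: (f x) (g x) => [? ?] [? ?] /=; rewrite mulrN opprK.
  by apply: (LZD) => //; exact: Lfun2_mul_Lfun1.
- have -> : (fun x => complex.Im (f x * (g x)^*%C)) =
    - 1 *: ((fun x => complex.Re (f x)) \* (fun x => complex.Im (g x))) +
    ((fun x => complex.Im (f x)) \* (fun x => complex.Re (g x))).
    apply/funext => x; rewrite scaleN1r.
    change (complex.Im (f x * (g x)^*%C) =
      - (complex.Re (f x) * complex.Im (g x)) +
      complex.Im (f x) * complex.Re (g x)).
    by case: (f x) (g x) => [? ?] [? ?] /=; rewrite mulrN.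
  by apply: (LZD) => //; exact: Lfun2_mul_Lfun1.
Qed.

(* Linear in the first argument, conjugate-linear in the second. *)
Definition sqdot (f g : sqintegrable) : R[i] :=
  cintegral (fun x => f x * (g x)^*%C).

Definition L2dot (u v : cL2) : R[i] := sqdot (repr u) (repr v).

Lemma L2dotE f g : L2dot (\pi_cL2 f) (\pi_cL2 g) = sqdot f g.
Proof.
apply: eq_cintegral_ae; try by apply: cLfun2_mulJ; exact: sqfunP.
by apply: filterS2 (cL2_reprP f) (cL2_reprP g) => x -> ->.
Qed.

Let sqdotZDl g : scalar (sqdot ^~ g).
Proof.
move=> a f h; rewrite /sqdot /= -cintegralZD; last 2 first.
- by apply: cLfun2_mulJ; exact: sqfunP.
- by apply: cLfun2_mulJ; exact: sqfunP.
congr cintegral; apply/funext => x.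
transitivity ((a * f x + h x) * (g x)^*%C); first by [].
by rewrite mulrDl mulrA.
Qed.

Let sqdotC f g : sqdot f g = (sqdot g f)^*%C.
Proof.
rewrite /sqdot -cintegralJ; last by apply: cLfun2_mulJ; exact: sqfunP.
by congr cintegral; apply/funext => x; rewrite rmorphM/= conjcK mulrC.
Qed.

Let L2dotZDl v : scalar (L2dot ^~ v).
Proof.
elim/quotW: v => g a; elim/quotW => f; elim/quotW => h.
rewrite cL2_piZ -pi_addr.
by rewrite (L2dotE (a *: f + h)) (L2dotE f) (L2dotE h) sqdotZDl.
Qed.

Let L2dotC u v : L2dot u v = (L2dot v u)^*%C.
Proof. by elim/quotW: u => f; elim/quotW: v => g; rewrite !L2dotE sqdotC. Qed.

Let L2dot_bilinear : bilinear_for *%R (Num.conj \; *%R) L2dot.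
Proof.
split=> [|u] //= a v w.
by rewrite L2dotC L2dotZDl (L2dotC u v) (L2dotC u w) rmorphD rmorphM.
Qed.

HB.instance Definition _ := bilinear_isBilinear.Build R[i] cL2 cL2 R[i]
  *%R (Num.conj \; *%R) L2dot L2dot_bilinear.

Let L2dot_hermitian u v : L2dot u v = (-1) ^+ false * Num.conj (L2dot v u).
Proof. by rewrite expr0 mul1r. Qed.

HB.instance Definition _ := isHermitianSesquilinear.Build R[i] cL2 false
  Num.conj L2dot L2dot_hermitian.

Let L2dot_gt0 u : u != 0 -> 0 < L2dot u u.
Proof.
elim/quotW: u => f f0; rewrite L2dotE.
have /andP[/Lfun1_integrable iRe _] := cLfun2_mulJ (sqfunP f) (sqfunP f).
pose h x := complex.Re (f x) ^+ 2 + complex.Im (f x) ^+ 2.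
have hE : (fun x => complex.Re (f x * (f x)^*%C)) = h.
  by apply/funext => x; rewrite /h; case: (f x) => a b /=; rewrite mulrN opprK.
have Im0 : (fun x => complex.Im (f x * (f x)^*%C)) = cst 0.
  apply/funext => x; case: (f x) => a b /=.
  by rewrite mulrN [b * a]mulrC addNr.
have h0 x : 0 <= h x by rewrite addr_ge0// sqr_ge0.
rewrite /sqdot /cintegral ltcE /= Im0 hE.
apply/andP; split; first by rewrite /Rintegral (integral0 mu setT); apply/eqP.
rewrite lt_neqAle; apply/andP; split; last first.
  by apply: Rintegral_ge0 => x _; exact: h0.
apply: contra f0 => /eqP h00; apply/eqP.
rewrite hE in iRe.
have : (\int[mu]_(x in setT) `|(EFin \o h) x| = 0)%E.
  under eq_integral do rewrite /= ger0_norm//.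
  by rewrite -(fineK (integrable_fin_num _ iRe))//; congr (_%:E).
move/(ae_eq_integral_abs _ measurableT (measurable_int mu iRe)) => ae0.
transitivity (\pi_cL2 (0 : sqintegrable)); last by rewrite pi_zeror.
apply/cL2P.
apply: filterS ae0 => x /(_ I) [/eqP].
rewrite paddr_eq0 ?sqr_ge0// !sqrf_eq0 => /andP[/eqP a0 /eqP b0].
by apply/eqP; rewrite eq_complex a0 b0 !eqxx.
Qed.

HB.instance Definition _ := isDotProduct.Build R[i] cL2 L2dot L2dot_gt0.

End complex_Lp.


HB.mixin Record isTopologicalGroup G of Group G & Topological G := {
  mulg_continuous : continuous (fun xy : G * G => (xy.1 * xy.2)%g) ;
  invg_continuous : continuous (fun x : G => (x^-1)%g) }.

#[short(type="topologicalGroupType")]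
HB.structure Definition TopologicalGroup :=
  (* pointed only because generated sigma-algebras live on pointed types *)
  {G of Group G & PointedTopological G & isTopologicalGroup G}.

Notation borel G := (g_sigma_algebraType (@open G)).

(* A left Haar measure: a nonzero left-invariant Radon measure on the Borel
   sets. *)
Record haarMeasure (G : topologicalGroupType) (R : realType) := HaarMeasure {
  haar :> {measure set (borel G) -> \bar R} ;
  haar_left : forall (s : G) (A : set (borel G)), measurable A ->
    haar [set (s * t)%g | t in A] = haar A ;
  haar_neq0 : haar setT != 0%E ;
  haar_compact : forall K : set G, compact K -> (haar K < +oo)%E ;
  haar_outer : forall A : set (borel G), measurable A ->
    haar A = ereal_inf [set haar U | U in [set U : set G | open U /\ A `<=` U]] ;
  haar_inner : forall U : set G, open U ->
    haar U = ereal_sup [set haar K | K in [set K : set G | compact K /\ K `<=` U]] }.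

Section translation.
Context (G : topologicalGroupType) (R : realType) (mu : haarMeasure G R).

Lemma continuous_mulgl (s : G) : continuous (fun t : G => (s * t)%g).
Proof.
move=> t; apply: (@continuous_comp _ _ _ (fun t => (s, t))
  (fun xy : G * G => (xy.1 * xy.2)%g)); last exact: mulg_continuous.
by apply: cvg_pair => //=; exact: cvg_cst.
Qed.

Lemma measurable_mulgl (s : G) :
  measurable_fun setT (fun t : borel G => (s * t)%g : borel G).
Proof.
apply: (@measurability _ _ (borel G) (borel G) setT _ (@open G)) => //.
move=> _ [U oU <-]; rewrite setTI; apply: sub_sigma_algebra.
by move/continuousP : (@continuous_mulgl s); exact.
Qed.

Lemma haar_mulgl (s : G) (A : set (borel G)) : measurable A ->
  mu ((fun t => (s * t)%g) @^-1` A) = mu A.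
Proof.
move=> mA; rewrite -[RHS](haar_left mu (s^-1)%g mA); congr (mu _).
apply/seteqP; split=> [t At|_ [t At <-]] /=; last by rewrite mulVKg.
by exists (s * t)%g => //; rewrite mulKg.
Qed.

Lemma ge0_integral_mulgl (s : G) (f : borel G -> \bar R) :
  measurable_fun [set: borel G] f -> (forall t, 0 <= f t)%E ->
  (\int[mu]_t f (s * t)%g = \int[mu]_t f t)%E.
Proof.
move=> mf f0; have ms := measurable_mulgl s.
transitivity (\int[pushforward mu (fun t : borel G => (s * t)%g : borel G)]_t f t)%E.
  by rewrite (ge0_integral_pushforward ms mu measurableT mf)// preimage_setT.
by apply: eq_measure_integral => A mA _; exact: haar_mulgl.
Qed.

Lemma Lfun2_mulgl (s : G) (f : borel G -> R) : f \in Lfun mu 2%:E ->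
  (fun t : borel G => f (s * t)%g) \in Lfun mu 2%:E.
Proof.
move=> /andP[]; rewrite !inE /= => mf; rewrite /finite_norm => nf.
apply/andP; split; rewrite inE /=.
  exact: (measurableT_comp mf (measurable_mulgl s)).
rewrite /finite_norm; move: nf; rewrite unlock /Lnorm.
rewrite -(ge0_integral_mulgl s)//=.
apply/measurable_EFinP.
apply: (@measurableT_comp _ _ _ _ _ _ (fun x : R => x `^ 2)%R) => //.
exact: measurableT_comp.
Qed.

Lemma ae_mulgl (s : G) (P : borel G -> Prop) :
  (\forall t \ae mu, P t) -> \forall t \ae mu, P (s * t)%g.
Proof.
move=> [N [mN N0 PN]]; exists ((fun t => (s * t)%g) @^-1` N); split.
- by rewrite -[X in measurable X]setTI; exact: measurable_mulgl.
- by rewrite haar_mulgl.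
- by move=> t /= nP; exact: PN.
Qed.

Lemma translate_subproof (s : G) (f : sqintegrable mu) :
  (fun t : borel G => f (s^-1 * t)%g) \in cLfun mu 2%:E.
Proof.
case/andP: (sqfunP f) => fr fi; apply/andP; split.
- exact: (Lfun2_mulgl s^-1%g fr).
- exact: (Lfun2_mulgl s^-1%g fi).
Qed.

Definition translate (s : G) (f : sqintegrable mu) : sqintegrable mu :=
  SqIntegrable (translate_subproof s f).

(* (lambda_s u)(t) = u(s^-1 t); independent of the representative by [lambdaE]. *)
Definition lambda (s : G) (u : cL2 mu) : cL2 mu := \pi_(cL2 mu) (translate s (repr u)).

Lemma lambdaE s f : lambda s (\pi_(cL2 mu) f) = \pi_(cL2 mu) (translate s f).
Proof. by apply/cL2P; exact: (ae_mulgl s^-1%g (cL2_reprP f)). Qed.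

End translation.

Section group_algebras.
Context (G : topologicalGroupType) (R : realType) (mu : haarMeasure G R).
Local Notation L2 := (cL2 mu).
Local Notation "''[' u , v ]" := (L2dot u v) : ring_scope.

Definition L2norm (u : L2) : R := Num.sqrt (complex.Re '[u, u]).

Definition opnorm_le (T : L2 -> L2) (c : R) :=
  forall u, L2norm (T u) <= c * L2norm u.

Definition bounded_op : set (L2 -> L2) :=
  [set T | linear T /\ exists c, opnorm_le T c].

(* [integrated_form f T] says that T = lambda(f), i.e. that T is the weakly
   defined operator integral of f(s) lambda_s ds. *)
Definition integrated_form (f : borel G -> R[i]) (T : L2 -> L2) :=
  bounded_op T /\
  forall u v, '[T u, v] = cintegral mu (fun s => f s * '[lambda s u, v]).

(* The operator-norm closure of lambda(L^1(G)). *)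
Definition Crstar : set (L2 -> L2) :=
  [set T | bounded_op T /\
    forall e : R, 0 < e -> exists f S,
      [/\ f \in cLfun mu 1, integrated_form f S & opnorm_le (T - S) e]].

Definition square_summable (xi : nat -> L2) :=
  cvgn (series (fun n => L2norm (xi n) ^+ 2)).

(* For square-summable xi, eta, these are exactly the weak*-continuous linear
   functionals T |-> sum_n (T xi_n, eta_n) on B(L^2(G)); the series converges
   absolutely. *)
Definition normal_functional (xi eta : nat -> L2) (T : L2 -> L2) : R[i] :=
  limn (series (fun n => complex.Re '[T (xi n), eta n])) +i*
  limn (series (fun n => complex.Im '[T (xi n), eta n])).

Definition weak_star_closure (A : set (L2 -> L2)) : set (L2 -> L2) :=
  [set T | bounded_op T /\
    forall (m : nat) (xi eta : 'I_m -> nat -> L2) (e : R),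
      (forall i, square_summable (xi i) /\ square_summable (eta i)) -> 0 < e ->
      exists2 S, A S &
        forall i, `|normal_functional (xi i) (eta i) (T - S)| < e%:C].

Definition VN : set (L2 -> L2) := weak_star_closure Crstar.

Definition coefficient (u v : L2) : G -> R[i] := fun s => '[lambda s u, v].

Definition fourier_algebra : set (G -> R[i]) :=
  [set f | exists u v, f = coefficient u v].

(* [pairing T f z] says <T, f> = z. The value (T u, v) does not depend on the
   representation f = coefficient u v when T is in VN(G), so that [pairing T f]
   is then a singleton for f in A(G). *)
Definition pairing (T : L2 -> L2) (f : G -> R[i]) : set R[i] :=
  [set z | exists u v, f = coefficient u v /\ z = '[T u, v]].

(* The norm of f as an element of the predual of VN(G), meaningful on A(G),
   which is a vector space. *)
Definition fourier_norm (f : G -> R[i]) : R :=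
  sup [set r : R | exists T z,
    [/\ VN T, opnorm_le T 1, pairing T f z & r%:C = `|z|]].

Definition J_ideal (E : set G) : set (G -> R[i]) :=
  [set f | fourier_algebra f /\ forall e : R, 0 < e -> exists g,
    [/\ fourier_algebra g, set_nbhs E [set s | g s = 0] &
        fourier_norm (f - g) < e]].

Definition annihilator (B : set (G -> R[i])) : set (L2 -> L2) :=
  [set T | VN T /\ forall f z, B f -> pairing T f z -> z = 0].

Definition U_set (E : set G) := annihilator (J_ideal E) `&` Crstar = [set 0].

End group_algebras.

(* Main.v *)
(* Write P_A for multiplication by the indicator of A on L^2(G).  If B A^-1 is
   contained in W, then (lambda_s P_A u, P_B v) = 0 for s outside W.  Hence for
   T in J(E)^perp the form (T P_A u, P_B v) vanishes as soon as A, B are compact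
   and B A^-1 misses E, and this vanishing is local in B A^-1, so that T has a
   smallest closed support S, a subset of E.  If S is nonempty, then it has an
   isolated point s, by Baire's theorem.  Approximating T by lambda(f) gives
   |(T P_A u, P_B v)| <= eps |P_A u| |P_B v| for B A^-1 in a small neighbourhood of
   s, because {s} is a null set in a non-discrete group.  Cutting u along a
   partition of G into small pieces A_i and v along the pieces s A_i, only the
   diagonal terms survive near s, and Cauchy-Schwarz bounds their sum by
   eps |u| |v|.  So T vanishes near s, a contradiction; hence S is empty and
   T = 0. *)
Require Import Defs.
From mathcomp Require Import all_boot all_order all_algebra.
From mathcomp Require Import complex.
From mathcomp Require Import all_classical all_reals all_analysis.
From mathcomp Require Import measurable_realfun.
From mathcomp Require Import ring lra.

Set Implicit Arguments.
Unset Strict Implicit.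
Unset Printing Implicit Defensive.

Import Order.TTheory GRing.Theory Num.Def Num.Theory.
Import numFieldNormedType.Exports.

Local Open Scope classical_set_scope.
Local Open Scope ring_scope.
Local Open Scope complex_scope.
Local Open Scope quotient_scope.

(** * Domination and small tails of integrals *)

Section integration.
Context d (T : measurableType d) (R : realType) (mu : {measure set T -> \bar R}).

(** The positive and negative parts of [h] lie below [g]. The integral of a nonnegative function is
    a supremum over the simple functions below it, hence monotone; so both parts have integrals
    between 0 and that of [g]. *)
Lemma normr_Rintegral_le (h g : T -> R) : mu.-integrable setT (EFin \o g) ->
  (forall x, `|h x| <= g x) -> `|\int[mu]_x h x| <= \int[mu]_x g x.
Proof.
move=> ig hg.
have g0 x : 0 <= g x by apply: le_trans (hg x).
have mono (k : T -> \bar R) : (forall x, 0 <= k x)%E ->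
    (forall x, k x <= (g x)%:E)%E ->
    (0 <= fine (\int[mu]_x k x) <= fine (\int[mu]_x (g x)%:E))%R /\
    (\int[mu]_x k x)%E \is a fin_num.
  move=> k0 kg.
  have kg' : (\int[mu]_x k x <= \int[mu]_x (g x)%:E)%E.
    rewrite !ge0_integralTE//.
    apply: le_ereal_sup => _ [s sk <-]; exists s => // x.
    exact: le_trans (sk x) (kg x).
  have fg : (\int[mu]_x (g x)%:E)%E \is a fin_num by exact: integrable_fin_num ig.
  have k0' : (0 <= \int[mu]_x k x)%E by exact: integral_ge0.
  have fk : (\int[mu]_x k x)%E \is a fin_num.
    rewrite ge0_fin_numE//; apply: le_lt_trans kg' _.
    by rewrite -ge0_fin_numE//; apply: integral_ge0 => x _; rewrite lee_fin.
  by split=> //; apply/andP; split; [exact: fine_ge0|exact: fine_le].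
rewrite /Rintegral integralE.
have [||/andP[p0 pg] pf] := mono ((EFin \o h) ^\+)%E.
- by move=> x; exact: funepos_ge0.
- move=> x; rewrite funeposE /= -EFin_max lee_fin ge_max g0 andbT.
  exact: le_trans (ler_norm _) (hg x).
have [||/andP[n0 ng] nf] := mono ((EFin \o h) ^\-)%E.
- by move=> x; exact: funeneg_ge0.
- move=> x; rewrite funenegE /= -EFin_max lee_fin ge_max g0 andbT.
  by apply: le_trans (hg x); rewrite -normrN; exact: ler_norm.
rewrite fineB//.
set a := fine _ in p0 pg *; set b := fine _ in n0 ng *; set c := fine _ in pg ng *.
by rewrite ler_norml; lra.
Qed.

(** Dominated convergence for [g] cut off to [C n]: a point off the null intersection leaves some
    [C n] and stays outside, as the sets decrease. *)
Lemma integral_small_tail (g : T -> R) (C : nat -> set T) (e : R) :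
  mu.-integrable setT (EFin \o g) -> (forall x, 0 <= g x) ->
  (forall n, measurable (C n)) ->
  (forall m n, (m <= n)%N -> C n `<=` C m) ->
  mu (\bigcap_n C n) = 0%E -> 0 < e ->
  exists n, \int[mu]_(x in C n) g x < e.
Proof.
move=> ig g0 mC dC C0 e0.
have [] := @dominated_convergence _ T R mu setT measurableT
  (fun n => (EFin \o g) \_ (C n)) (cst 0%E) (EFin \o g).
- move=> n; apply/(measurable_restrictT _ (mC n)).
  exact: measurable_funTS (measurable_int _ ig).
- exact: measurable_cst.
- exists (\bigcap_n C n); split => //.
    exact: bigcapT_measurable.
  move=> x /= nx n _; apply: contrapT => nC; apply: nx => _.
  apply: cvg_near_cst; exists n => // m /= nm.
  by rewrite patchE memNset// => Cm; apply: nC; exact: dC Cm.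
- exact: ig.
- apply: aeW => x n _; rewrite patchE; case: ifP => _; last first.
    by rewrite abse0 lee_fin.
  by rewrite /= ger0_norm.
move=> _ _; rewrite integral0 => /fine_cvgP[_] /cvgrPdist_lt /(_ e e0)[n _ /(_ n)].
rewrite /= leqnn => /(_ isT); rewrite sub0r normrN.
rewrite -integral_mkcond => h; exists n.
exact: le_lt_trans (ler_norm _) h.
Qed.

End integration.

(** * Real-valued moduli of complex numbers *)

Section complex_modulus.
Context (R : realType).
Implicit Types z w : R[i].

(* The l^1 modulus keeps all estimates in R. *)
Definition abs1 z : R := `|complex.Re z| + `|complex.Im z|.

Definition csq z : R := complex.Re z ^+ 2 + complex.Im z ^+ 2.

Lemma abs1_ge0 z : 0 <= abs1 z.
Proof. by rewrite addr_ge0. Qed.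

Lemma abs1D z w : abs1 (z + w) <= abs1 z + abs1 w.
Proof.
case: z w => [a b] [c e]; rewrite /abs1 /=.
by rewrite addrACA lerD// ler_normD.
Qed.

Lemma abs1_0 : abs1 (0 : R[i]) = 0.
Proof. by rewrite /abs1 /= normr0 addr0. Qed.

Lemma abs1_small_eq0 z : (forall e : R, 0 < e -> abs1 z <= e) -> z = 0.
Proof.
move=> h; have : abs1 z <= 0 by apply/ler_addgt0Pl => e e0; rewrite addr0; exact: h.
rewrite le_eqVlt ltNge abs1_ge0 orbF paddr_eq0// !normr_eq0 => /andP[/eqP a0 /eqP b0].
by apply/eqP; rewrite eq_complex a0 b0 !eqxx.
Qed.

Lemma csq_ge0 z : 0 <= csq z.
Proof. by rewrite addr_ge0// sqr_ge0. Qed.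

Lemma csqE z : csq z = complex.Re (z * z^*%C).
Proof. by case: z => a b; rewrite /csq /= mulrN opprK. Qed.

Lemma csq0 : csq (0 : R[i]) = 0.
Proof. by rewrite /csq /= expr0n addr0. Qed.

End complex_modulus.

(** * Norm and Cauchy-Schwarz inequality on L^2 *)

Section L2_geometry.
Context d (T : measurableType d) (R : realType) (mu : {measure set T -> \bar R}).
Local Notation L2 := (cL2 mu).
Local Notation "''[' u , v ]" := (L2dot u v) : ring_scope.
Implicit Types (u v w : L2) (f g : sqintegrable mu).

(** The squared norm as a real number; [L2norm u] and [Num.sqrt (sqn u)] are convertible, which
    [abs1_op] relies on. *)
Definition sqn u : R := complex.Re '[u, u].

Lemma dotDl u v w : '[u + v, w] = '[u, w] + '[v, w].
Proof. exact: linearDl. Qed.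

Lemma dotDr u v w : '[u, v + w] = '[u, v] + '[u, w].
Proof. exact: linearDr. Qed.

Lemma dot0l u : '[0, u] = 0.
Proof. exact: linear0l. Qed.

Lemma dotBl u v w : '[u - v, w] = '[u, w] - '[v, w].
Proof. exact: linearBl. Qed.

Lemma dotZl a u w : '[a *: u, w] = a * '[u, w].
Proof. exact: linearZl_LR. Qed.

Lemma dotC u v : '[u, v] = ('[v, u])^*%C.
Proof. by rewrite [LHS](hermC (@L2dot _ _ _ mu)) expr0 mul1r. Qed.

Lemma csq_integrable f : mu.-integrable setT (EFin \o (fun x => csq (f x))).
Proof.
have /andP[/Lfun1_integrable iRe _] := cLfun2_mulJ (sqfunP f) (sqfunP f).
by under [X in EFin \o X]eq_fun do rewrite csqE.
Qed.

Lemma sqn_pi f : sqn (\pi_L2 f) = \int[mu]_x csq (f x).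
Proof.
rewrite /sqn L2dotE /sqdot /cintegral /=.
by apply: eq_Rintegral => x _; rewrite csqE.
Qed.

Lemma sqn_ge0 u : 0 <= sqn u.
Proof.
elim/quotW: u => f; rewrite sqn_pi; apply: Rintegral_ge0 => x _; exact: csq_ge0.
Qed.

Lemma dot_eq0 u : '[u, u] = 0 -> u = 0.
Proof. by move/eqP; rewrite dnorm_eq0 => /eqP. Qed.

Lemma dotuu u : '[u, u] = (sqn u)%:C.
Proof.
rewrite /sqn; have := dotC u u; case: '[u, u] => a b /= [] /eqP.
by rewrite -addr_eq0 -mulr2n mulrn_eq0 /= => /eqP ->.
Qed.

Lemma sqn_eq0 u : sqn u = 0 -> u = 0.
Proof. by move=> u0; apply: dot_eq0; rewrite dotuu u0. Qed.

Lemma sqnD u v : sqn (u + v) = sqn u + sqn v + 2 * complex.Re '[u, v].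
Proof.
rewrite /sqn dotDl !dotDr (dotC v u).
case: '[u, u] => a b; case: '[u, v] => c e; case: '[v, v] => a' b' /=; ring.
Qed.

Lemma sqnZ (k : R) u : sqn (k%:C *: u) = k ^+ 2 * sqn u.
Proof.
rewrite /sqn dotZl dotC dotZl.
by case: '[u, u] => a b /=; ring.
Qed.

Lemma ReCauchySchwarz u v : `|complex.Re '[u, v]| <= Num.sqrt (sqn u) * Num.sqrt (sqn v).
Proof.
rewrite -sqrtrM ?sqn_ge0// -(ler_pXn2r (ltn0Sn 1)) ?nnegrE ?sqrtr_ge0//.
rewrite sqr_sqrtr ?mulr_ge0 ?sqn_ge0// real_normK ?num_real//.
have [v0|v0] := eqVneq (sqn v) 0.
  by rewrite v0 mulr0 dotC (sqn_eq0 v0) dot0l /= expr0n.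
have vp : 0 < sqn v by rewrite lt_neqAle eq_sym v0 sqn_ge0.
set r := complex.Re _.
(* The real multiple of [v] nearest to [u] is subtracted; the squared norm of the difference, times
   [sqn v], is the gap in the inequality. *)
have := sqn_ge0 (u + (- (r / sqn v))%:C *: v).
rewrite sqnD sqnZ dotC dotZl (dotC v u).
have -> : complex.Re ((- (r / sqn v))%:C * ('[u, v]^*)%C)^*%C = - (r / sqn v) * r.
  by rewrite /r; case: '[u, v] => a b /=; ring.
have -> : sqn u + (- (r / sqn v)) ^+ 2 * sqn v + 2 * (- (r / sqn v) * r) =
  (sqn u * sqn v - r ^+ 2) / sqn v by field.
by rewrite pmulr_lge0 ?invr_gt0// subr_ge0.
Qed.

(** The factor 2 counts the real and the imaginary part; the latter is, up to sign, a real part once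
    [u] is replaced by ['i *: u], which has the same norm. *)
Lemma abs1_dot u v : abs1 '[u, v] <= 2 * (Num.sqrt (sqn u) * Num.sqrt (sqn v)).
Proof.
rewrite mulr2n mulrDl mul1r lerD ?ReCauchySchwarz//.
have -> : complex.Im '[u, v] = - complex.Re '['i *: u, v].
  by rewrite dotZl; case: '[u, v] => a b /=; ring.
rewrite normrN; apply: le_trans (ReCauchySchwarz _ _) _.
suff -> : sqn ('i *: u) = sqn u by [].
by rewrite /sqn dotZl dotC dotZl; case: '[u, u] => a b /=; ring.
Qed.

End L2_geometry.

(** * Multiplication by indicator functions on L^2 *)

Section restriction.
Context d (T : measurableType d) (R : realType) (mu : {measure set T -> \bar R}).
Local Notation L2 := (cL2 mu).
Local Notation "''[' u , v ]" := (L2dot u v) : ring_scope.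
Implicit Types (u v w : L2) (f g : sqintegrable mu) (A B : set T).

Lemma Lfun2_cut A (f : T -> R) : measurable A -> f \in Lfun mu 2%:E ->
  (fun x => if x \in A then f x else 0) \in Lfun mu 2%:E.
Proof.
move=> mA /andP[]; rewrite !inE /= => mf; rewrite /finite_norm => nf.
have mg : measurable_fun setT (fun x => if x \in A then f x else 0).
  have := (measurable_restrictT f mA).1 (measurable_funTS mf).
  by congr measurable_fun; apply/funext => x; rewrite patchE.
apply/andP; split; rewrite inE //= /finite_norm.
move: nf; rewrite unlock /Lnorm => /lty_poweRy h.
have {}h := h (ltac:(by [])).
apply: poweR_lty; apply: le_lt_trans h.
have mp (h : T -> R) : measurable_fun setT h ->
    measurable_fun setT (fun x => `|(h x)%:E| `^ 2)%E.
  move=> mh; apply/measurable_EFinP.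
  apply: (@measurableT_comp _ _ _ _ _ _ (fun x : R => x `^ 2)%R) => //.
  exact: measurableT_comp.
apply: ge0_le_integral => //.
- by move=> x _; exact: poweR_ge0.
- exact: mp.
- exact: mp.
- move=> x _ /=; case: ifP => // _.
  by rewrite normr0 powR0// lee_fin powR_ge0.
Qed.

(* Junk value [0] when [A] is not measurable. *)
Definition cut A f : sqintegrable mu :=
  insubd (0 : sqintegrable mu) (fun x => if x \in A then f x else 0).

Lemma cutE A f x : measurable A -> cut A f x = if x \in A then f x else 0.
Proof.
move=> mA; rewrite /cut -[LHS]/(val (insubd _ _) x) insubdK//.
case/andP: (sqfunP f) => fr fi; apply/andP; split.
- rewrite [X in X \in _](_ : _ = fun y => if y \in A then complex.Re (f y) else 0).
    exact: Lfun2_cut.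
  by apply/funext => y; case: ifP.
- rewrite [X in X \in _](_ : _ = fun y => if y \in A then complex.Im (f y) else 0).
    exact: Lfun2_cut.
  by apply/funext => y; case: ifP.
Qed.

(** This is the projection P_A, defined through a representative; [restrE] removes the choice for
    measurable [A]. *)
Definition restr A u : L2 := \pi_L2 (cut A (repr u)).

Lemma restrE A f : measurable A -> restr A (\pi_L2 f) = \pi_L2 (cut A f).
Proof.
move=> mA; apply/cL2P; apply: filterS (cL2_reprP f) => x fx.
by rewrite !cutE// fx.
Qed.

Lemma eq_pi f g : f =1 g -> \pi_L2 f = \pi_L2 g.
Proof. by move=> fg; apply/cL2P; apply: aeW => x; exact: fg. Qed.

Lemma restr_restr A B u : measurable A -> measurable B ->
  restr A (restr B u) = restr (A `&` B) u.
Proof.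
move=> mA mB; have mI := measurableI _ _ mA mB.
elim/quotW: u => f; rewrite (restrE f mB) (restrE (cut B f) mA) (restrE f mI).
apply: eq_pi => x; rewrite !cutE//.
by rewrite in_setI; case: (x \in A).
Qed.

Lemma restrT u : restr setT u = u.
Proof.
elim/quotW: u => f; rewrite restrE//; apply: eq_pi => x.
by rewrite cutE// in_setT.
Qed.

Lemma restrU A B u : measurable A -> measurable B -> A `&` B = set0 ->
  restr (A `|` B) u = restr A u + restr B u.
Proof.
move=> mA mB AB; elim/quotW: u => f; rewrite !restrE//; last exact: measurableU.
rewrite -pi_addr; apply: eq_pi => x.
rewrite sqfunD !cutE//; last exact: measurableU.
rewrite in_setU; have [xA|xA] := boolP (x \in A); have [xB|xB] := boolP (x \in B) => /=.
- by exfalso; have : (A `&` B) x; [split; exact: set_mem|rewrite AB].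
- by rewrite addr0.
- by rewrite add0r.
- by rewrite addr0.
Qed.

Lemma sqn_restr A f : measurable A ->
  sqn (restr A (\pi_L2 f)) = \int[mu]_(x in A) csq (f x).
Proof.
move=> mA; rewrite restrE// sqn_pi [RHS]Rintegral_mkcond; apply: eq_Rintegral => x _.
by rewrite patchE cutE//; case: ifP => // _; rewrite csq0.
Qed.

Lemma dot_restr_disjoint A B u v : measurable A -> measurable B -> A `&` B = set0 ->
  '[restr A u, restr B v] = 0.
Proof.
move=> mA mB AB; elim/quotW: u => f; elim/quotW: v => g.
rewrite !restrE// L2dotE /sqdot.
rewrite [X in cintegral mu X](_ : _ = fun=> 0).
  by rewrite /cintegral /Rintegral /= !integral0.
apply/funext => x; rewrite !cutE//.
have [xA|xA] := boolP (x \in A); have [xB|xB] := boolP (x \in B) .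
- by exfalso; have : (A `&` B) x; [split; exact: set_mem|rewrite AB].
- by rewrite conjc0 mulr0.
- by rewrite mul0r.
- by rewrite mul0r.
Qed.

Lemma sqn_restrU A B u : measurable A -> measurable B -> A `&` B = set0 ->
  sqn (restr (A `|` B) u) = sqn (restr A u) + sqn (restr B u).
Proof.
by move=> mA mB AB; rewrite restrU// sqnD dot_restr_disjoint//= mulr0 addr0.
Qed.

Lemma restr_split A B u : measurable A -> measurable B ->
  restr A u = restr (A `&` B) u + restr (A `\` B) u.
Proof.
move=> mA mB; rewrite -restrU; first by rewrite setUIDK.
- exact: measurableI.
- exact: measurableD.
- by rewrite setDE setIACA setICr setI0.
Qed.

Lemma sqn_restr_le A B u : measurable A -> measurable B -> A `<=` B ->
  sqn (restr A u) <= sqn (restr B u).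
Proof.
move=> mA mB AB; have mD := measurableD mB mA.
by rewrite -(setDUK AB) sqn_restrU// ?setDIK ?lerDl ?sqn_ge0.
Qed.

(** The remainders of [A] outside [D n] decrease to the empty set, so [integral_small_tail] applies
    to the squared modulus. *)
Lemma sqn_restr_small A (D : nat -> set T) u (e : R) : measurable A ->
  (forall n, measurable (D n)) -> (forall m n, (m <= n)%N -> D m `<=` D n) ->
  0 < e -> A `<=` \bigcup_n D n -> exists n, sqn (restr (A `\` D n) u) < e.
Proof.
move=> mA mD dD e0 AD; elim/quotW: u => f.
have C0 : mu (\bigcap_n (A `\` D n)) = 0%E.
  rewrite (_ : \bigcap_n _ = set0) ?measure0//; apply/seteqP; split => // x h.
  by have [Ax _] := h 0%N I; have [n _ Dn] := AD x Ax; have [] := h n I.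
have [|n hn] := integral_small_tail (csq_integrable f) (fun x => csq_ge0 (f x))
  (fun n => measurableD mA (mD n)) _ C0 e0.
  by move=> m n mn x [Ax Dx]; split => // /(dD _ _ mn).
by exists n; rewrite sqn_restr//; exact: measurableD.
Qed.

End restriction.

(** * Bounded forms and the pairs of sets that they annihilate *)

Section forms.
Context d (T : measurableType d) (R : realType) (mu : {measure set T -> \bar R}).
Local Notation L2 := (cL2 mu).
Implicit Types (u v w : L2) (A B : set T) (b : L2 -> L2 -> R[i]).

(** Additivity and boundedness, without scalars, form a notion symmetric in the two arguments;
    [bounded_formC] thus carries results from one argument to the other. *)
Definition bounded_form b :=
  [/\ forall u v w, b (u + v) w = b u w + b v w,
      forall u v w, b u (v + w) = b u v + b u w &
      exists c, forall u v, abs1 (b u v) <= c * (Num.sqrt (sqn u) * Num.sqrt (sqn v))].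

Lemma bounded_formC b : bounded_form b -> bounded_form (fun u v => b v u).
Proof.
move=> [bl br [c bc]]; split; [by move=> *; exact: br|by move=> *; exact: bl|].
by exists c => u v; rewrite (mulrC (Num.sqrt (sqn u))).
Qed.

(** The part of [u] on [A] outside [D n] is small in norm, so boundedness of [b] carries a bound on
    the truncations over to all of [A]. *)
Lemma form_limit b A (D : nat -> set T) u w (e : R) : bounded_form b ->
  measurable A -> (forall n, measurable (D n)) ->
  (forall m n, (m <= n)%N -> D m `<=` D n) -> A `<=` \bigcup_n D n ->
  (forall n, abs1 (b (restr (A `&` D n) u) w) <= e) ->
  abs1 (b (restr A u) w) <= e.
Proof.
move=> [bl _ [c bc]] mA mD dD AD be; apply/ler_addgt0Pr => k k0.
(* With s the norm of the remainder and t that of [w], the error is at most |c| s t, hence at most s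
   [M]; the added 1 makes [M] positive. *)
pose M := `|c| * Num.sqrt (sqn w) + 1.
have M0 : 0 < M by rewrite ltr_wpDl// mulr_ge0// sqrtr_ge0.
have [|n hn] := sqn_restr_small u mA mD dD _ AD (e := (k / M) ^+ 2).
  by rewrite exprn_gt0// divr_gt0.
rewrite (restr_split u mA (mD n)) bl; apply: le_trans (abs1D _ _) _.
apply: lerD (be n) _; apply: le_trans (bc _ _) _.
have {}hn : Num.sqrt (sqn (restr (A `\` D n) u)) <= k / M.
  by rewrite -(ger0_norm (ltW (divr_gt0 k0 M0))) -sqrtr_sqr ler_wsqrtr// ltW.
set s := Num.sqrt _ in hn *; set t := Num.sqrt _ in M M0 hn *.
have s0 : 0 <= s by exact: sqrtr_ge0.
have t0 : 0 <= t by exact: sqrtr_ge0.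
apply: (@le_trans _ _ (s * M)).
  rewrite (_ : s * M = `|c| * (s * t) + s); last by rewrite /M; ring.
  by apply: ler_wpDr => //; rewrite ler_wpM2r ?mulr_ge0// ler_norm.
by rewrite -ler_pdivlMr.
Qed.

Definition kills b A B := forall u v, b (restr A u) (restr B v) = 0.

Lemma kills_sub b A A' B B' : measurable A -> measurable A' ->
  measurable B -> measurable B' -> A' `<=` A -> B' `<=` B ->
  kills b A B -> kills b A' B'.
Proof.
move=> mA mA' mB mB' AA BB k u v.
have -> : restr A' u = restr A (restr A' u).
  by rewrite restr_restr//; congr restr; apply/esym/setIidPr.
have -> : restr B' v = restr B (restr B' v).
  by rewrite restr_restr//; congr restr; apply/esym/setIidPr.
exact: k.
Qed.

Lemma kills_set0 b B : bounded_form b -> kills b set0 B.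
Proof.
move=> [bl _ _] u v.
(* The empty set is a disjoint union of two empty sets, so the value of [b] equals its own
   double. *)
have h : restr set0 u + restr set0 u = restr set0 u :> L2.
  by rewrite -{3}(setU0 set0) restrU// setI0.
by apply: (@addIr _ (b (restr set0 u) (restr B v))); rewrite -bl h add0r.
Qed.

Lemma kills_setU b A A' B : bounded_form b -> measurable A -> measurable A' ->
  measurable B -> kills b A B -> kills b A' B -> kills b (A `|` A') B.
Proof.
move=> [bl _ _] mA mA' mB k k' u v; have mU := measurableU _ _ mA mA'.
rewrite (restr_split u mU mA) bl.
rewrite (kills_sub mA (measurableI _ _ mU mA) mB mB _ _ k) ?add0r//.
apply: (kills_sub mA' (measurableD mU mA) mB mB _ _ k') => //.
by move=> x [[]].
Qed.

(** Finite unions follow from additivity; [form_limit], with every positive [e] as bound, then gives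
    the countable union. *)
Lemma kills_bigcup b (A : nat -> set T) B : bounded_form b ->
  (forall n, measurable (A n)) -> measurable B ->
  (forall n, kills b (A n) B) -> kills b (\bigcup_n A n) B.
Proof.
move=> bb mA mB k.
pose D n := \bigcup_(i in `I_n) A i.
have mD n : measurable (D n) by exact: bigcup_measurable.
have kD n : kills b (D n) B.
  elim: n => [|n IH]; first by rewrite /D II0 bigcup_set0; exact: kills_set0.
  rewrite /D IIS bigcup_setU bigcup_set1; apply: kills_setU => //; exact: mD.
have mU : measurable (\bigcup_n A n) by exact: bigcupT_measurable.
move=> u v; apply: abs1_small_eq0 => e e0.
apply: (form_limit bb mU mD).
- by move=> m n mn x [i /= im Ai]; exists i => //=; exact: leq_trans mn.
- by move=> x [n _ Anx]; exists n.+1 => //; exists n => /=.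
- move=> n; rewrite (kills_sub (mD n) (measurableI _ _ mU (mD n)) mB mB _ _ (kD n))//.
  by rewrite abs1_0 ltW.
Qed.

Lemma killsC b A B : kills (fun u v => b v u) B A <-> kills b A B.
Proof. by split=> k u v; exact: k. Qed.

Lemma kills_bigcup_r b A (B : nat -> set T) : bounded_form b ->
  measurable A -> (forall n, measurable (B n)) ->
  (forall n, kills b A (B n)) -> kills b A (\bigcup_n B n).
Proof.
move=> bb mA mB k; apply/killsC; apply: kills_bigcup => //; first exact: bounded_formC.
by move=> n; apply/killsC.
Qed.

End forms.

(** * Compactness, countability and Baire's argument *)

Section topology.
Context (X : topologicalType).
Implicit Types (A B K O U V S : set X) (x : X).

(** Compactness as an induction principle. If [Q K] failed, the sets [A] with [Q] true of [K] minus
    [A] would form a proper filter. At a cluster point in [K], a neighbourhood with [Q] would have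
    to meet its own complement, which lies in the filter. *)
Lemma compact_ideal K (Q : set X -> Prop) : compact K -> Q set0 ->
  (forall A B, B `<=` A -> Q A -> Q B) ->
  (forall A B, Q A -> Q B -> Q (A `|` B)) ->
  (forall x, K x -> exists2 N, nbhs x N & Q N) -> Q K.
Proof.
move=> cK Q0 Qs Qu QK; apply: contrapT => nQ.
pose F := [set A | Q (K `\` A)].
have FF : ProperFilter F.
  split; first by rewrite /F /= setD0.
  split; rewrite /F /=; first by rewrite setDT.
    by move=> A B QA QB; rewrite /= setDIr; exact: Qu.
  by move=> A B AB; apply: Qs => x [Kx nB]; split => // /AB.
have FK : F K by rewrite /F /= setDv.
have [x [Kx clx]] := cK _ FF FK.
have [N xN QN] := QK x Kx.
have FN : F (~` N) by apply: Qs QN => y [_ /contrapT].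
by have [y [nNy Ny]] := clx _ _ FN xN.
Qed.

(** Adding [x0] supplies a value when [A] is empty, so that a sequence enumerates the set in every
    case. *)
Lemma countable_range (T : Type) (A : set T) (x0 : T) : countable A ->
  exists f : nat -> T, x0 |` A = range f.
Proof.
move=> /pfcard_geP[->|[f]].
  exists (fun=> x0); rewrite setU0; apply/seteqP; split => [_ ->|_ [_ _ <-]//].
  by exists 0%N.
exists (fun n => if n is k.+1 then f k else x0); apply/seteqP; split.
  move=> x [->|/(@surj _ _ _ _ f)[n _ <-]]; first by exists 0%N.
  by exists n.+1.
by move=> _ [[|n] _ <-]; [left|right; exact: 'funS_f].
Qed.

(** Lindelof's argument: the basic open sets with [P] are countably many, and they cover [O] because
    [P] is hereditary. [P set0] lets [set0] pad the enumeration. *)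
Lemma second_countable_cover O (P : set X -> Prop) : @second_countable X ->
  P set0 -> (forall U V, V `<=` U -> P U -> P V) ->
  (forall x, O x -> exists2 N, nbhs x N & P N) ->
  exists f : nat -> set X,
    [/\ forall n, open (f n), forall n, P (f n) & O `<=` \bigcup_n f n].
Proof.
move=> [B cB [oB bB]] P0 Ps PO.
pose A := [set U | B U /\ P U].
have cA : countable A by apply: sub_countable cB; apply: subset_card_le => U [].
have [f Af] := countable_range set0 cA.
have Afn n : f n = set0 \/ A (f n).
  have : range f (f n) by exists n.
  by rewrite -Af.
exists f; split => [n|n|x Ox].
- by have [->|[/oB]] := Afn n; [exact: open0|].
- by have [->|[]] := Afn n.
- have [N xN PN] := PO x Ox.
  have [U [BU Ux] UN] := bB x N xN.
  have : (set0 |` A) U by right; split => //; exact: Ps PN.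
  by rewrite Af => -[n _ fn]; exists n => //; rewrite fn.
Qed.

Context (hX : hausdorff_space X) (lX : locally_compact [set: X]).

Lemma compact_nbhs x U : nbhs x U ->
  exists K, [/\ compact K, nbhs x K & K `<=` U].
Proof.
move=> xU; have [V + [cV clV]] := @lX x I.
rewrite withinET => xV.
have [W xW WU] := compact_regular hX cV xV xU.
exists (closure W `&` V); split.
- by rewrite setIC; apply: compact_closedI => //; exact: closed_closure.
- by apply: filterI => //; apply: filterS xW; exact: subset_closure.
- by move=> y [/WU].
Qed.

(** Every point of [O] has a compact neighbourhood inside [O], and countably many of these
    suffice. *)
Lemma open_sigma_compact O : @second_countable X -> open O ->
  exists2 K : nat -> set X, (forall n, compact (K n)) & O = \bigcup_n K n.
Proof.
move=> sX oO; pose P U := exists2 K, compact K & U `<=` K /\ K `<=` O.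
have [||x Ox|f [_ Pf Of]] := @second_countable_cover O P sX.
- by exists set0; [exact: compact0|split].
- by move=> U V VU [K cK [UK KO]]; exists K => //; split => //; exact: subset_trans UK.
- have [K [cK xK KO]] := compact_nbhs (open_nbhs_nbhs (conj oO Ox)).
  by exists K => //; exists K; [|split].
have /choice[K PK] n : exists K, compact K /\ (f n `<=` K /\ K `<=` O).
  by have [K] := Pf n; exists K.
exists K => [n|]; first by have [] := PK n.
apply/seteqP; split=> [x /Of[n _ fx]|x [n _ Kx]].
  by exists n => //; have [_ [h _]] := PK n; exact: h.
by have [_ [_ h]] := PK n; exact: h.
Qed.

Lemma second_countable_nbhs_base x : @second_countable X ->
  exists W : nat -> set X,
    [/\ forall n, open (W n), forall n, W n x,
        forall m n, (m <= n)%N -> W n `<=` W m & \bigcap_n W n = [set x]].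
Proof.
move=> [B cB [oB bB]].
pose A := [set U | B U /\ U x].
have cA : countable A by apply: sub_countable cB; apply: subset_card_le => U [].
have [f Af] := countable_range setT cA.
have fP n : open (f n) /\ f n x.
  have : range f (f n) by exists n.
  by rewrite -Af => -[->|[/oB]] //; split => //; exact: openT.
exists (fun n => \bigcap_(i in `I_n.+1) f i); split.
- move=> n; elim: n.+1 => [|k IH]; first by rewrite II0 bigcap_set0; exact: openT.
  by rewrite IIS bigcap_setU bigcap_set1; apply: openI => //; have [] := fP k.
- by move=> n i _; have [] := fP i.
- by move=> m n mn y h i /= im; apply: h => /=; exact: leq_trans mn.
apply/seteqP; split => [y h|_ -> n _ i _]; last by have [] := fP i.
(* In a Hausdorff space it suffices that all neighbourhoods of [x] and of [y] meet; [y] itself is a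
   common point, since it lies in every basic neighbourhood of [x]. *)
apply/esym/hX => U V xU yV.
have [W [BW Wx] WU] := bB x U xU.
have : range f W by rewrite -Af; right.
move=> [n _ fn]; exists y; split; last exact: nbhs_singleton.
by apply: WU; rewrite -fn; exact: (h n I n (ltnSn n)).
Qed.

(** Baire's argument: were no point isolated, decreasing compact sets whose interiors meet [S] could
    avoid the points of an enumeration one by one, and a common point of these sets in [S] would be
    missing from it. *)
Lemma closed_countable_isolated S : closed S -> countable S -> S !=set0 ->
  exists s V, [/\ open V, V s, S s & V `&` S `<=` [set s]].
Proof.
move=> clS cS [s0 Ss0]; apply: contrapT => noiso.
have [f] := countable_range s0 cS; rewrite (_ : _ |` _ = S); last by apply/setUidPr => _ ->.
  move=> Sf.
pose st := {K : set X | compact K /\ (interior K `&` S) !=set0}.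
have step (n : nat) (p : st) : exists q : st, sval q `<=` sval p /\ ~ sval q (f n).
  case: p => K [cK [x [Kx Sx]]] /=.
  have [y [Ky Sy yf]] : exists y, [/\ interior K y, S y & y <> f n].
    (* If the point at hand is [f n], it is not isolated, so the interior of [K] holds another point
       of [S]. *)
    have [xf|] := pselect (x = f n); last by exists x.
    apply: contrapT => h; apply: noiso.
    exists x, (interior K); split => //; first exact: open_interior.
    move=> y [Ky Sy]; apply: contrapT => yx; apply: h; exists y; split => //.
    by rewrite -xf.
  have yN : nbhs y (interior K `&` ~` [set f n]).
    apply: open_nbhs_nbhs; split; last by split.
    apply: openI; first exact: open_interior.
    apply: closed_openC; apply: compact_closed => //; exact: compact_set1.
  have [L [cL yL LK]] := compact_nbhs yN.
  have Lst : compact L /\ (interior L `&` S) !=set0 by split => //; exists y; split.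
  exists (exist _ L Lst) => /=; split=> [z /LK[/interior_subset]//|/LK[_]].
  exact.
have [L [cL xL _]] := compact_nbhs (@filterT _ (nbhs s0) _).
have Lst : compact L /\ (interior L `&` S) !=set0 by split => //; exists s0; split.
(* The index travels with the compact set, so that step n excludes exactly [f n]. *)
have {}step : forall p : nat * st, {q : nat * st |
    q.1 = p.1.+1 /\ (sval q.2 `<=` sval p.2 /\ ~ sval q.2 (f p.1))}.
  move=> [n p]; apply: cid; have [q hq] := step n p; by exists (n.+1, q).
have [g [g0 gS]] := dependent_choice step (0%N, exist _ L Lst).
have g1 n : (g n).1 = n.
  by elim: n => [|n IH]; [rewrite g0|rewrite (gS n).1 IH].
have dec m n : (m <= n)%N -> sval (g n).2 `<=` sval (g m).2.
  elim: n => [|n IH]; first by rewrite leqn0 => /eqP ->.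
  rewrite leq_eqVlt => /orP[/eqP -> //|]; rewrite ltnS => /IH.
  by apply: subset_trans; have [_ []] := gS n.
(* Otherwise the complements of the sets [C n] cover the first compact set. By compactness one [C n]
   would then be empty, yet it contains a point of [S]. *)
have : \bigcap_n (sval (g n).2 `&` S) !=set0.
  pose C n := sval (g n).2 `&` S.
  have [cK _] := svalP (g 0%N).2.
  apply: contrapT => C0.
  suff [n /(_ _ _)/= h] : exists n, forall y, sval (g 0%N).2 y -> ~ C n y.
    have [_ [y [/interior_subset Ky Sy]]] := svalP (g n).2.
    by apply: (h y); [exact: dec Ky|split].
  pose Q A := exists n, forall y, A y -> ~ C n y.
  apply: (@compact_ideal _ Q) => //.
  - by exists 0%N.
  - by move=> A B BA [n h]; exists n => y /BA; exact: h.
  - move=> A B [n hn] [m hm]; exists (maxn n m) => y [Ay|By] [Ky Sy].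
      by apply: (hn y) => //; split => //; apply: dec Ky; exact: leq_maxl.
    by apply: (hm y) => //; split => //; apply: dec Ky; exact: leq_maxr.
  - move=> y _; apply: contrapT => hy; apply: C0; exists y => n _.
    apply: contrapT => nCy; apply: hy; exists (~` C n); last by exists n.
    apply: open_nbhs_nbhs; split => //; apply: closed_openC; apply: closedI => //.
    by apply: compact_closed => //; have [] := svalP (g n).2.
move=> [x h]; have [_ Sx] := h 0%N I.
(* The common point is some [f n], which was excluded in passing from stage n to stage n+1. *)
move: Sx; rewrite Sf => -[n _ fx]; have [gx _] := h n.+1 I.
by have [_ [_]] := gS n; rewrite g1 fx.
Qed.

End topology.

(** * Supports of forms on L^2 of a group *)

Section support.
Context (G : topologicalGroupType) (R : realType) (mu : haarMeasure G R).
Context (hG : hausdorff_space G) (lG : locally_compact [set: G])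
  (sG : @second_countable G).
Local Notation L2 := (cL2 mu).
Local Notation restr := (@restr _ (borel G) R mu).
Local Notation kills := (@kills _ (borel G) R mu).
Implicit Types (u v w : L2) (A B K V W : set G) (b : L2 -> L2 -> R[i]) (s x y : G).

Lemma open_borel A : open A -> measurable (A : set (borel G)).
Proof. exact: sub_sigma_algebra. Qed.

Lemma closed_borel A : closed A -> measurable (A : set (borel G)).
Proof.
by move=> clA; rewrite -[A]setCK; apply: measurableC; apply: open_borel; exact: closed_openC.
Qed.

Lemma compact_borel A : compact A -> measurable (A : set (borel G)).
Proof. by move=> cA; apply: closed_borel; exact: compact_closed. Qed.

Lemma continuous_divg : continuous (fun p : G * G => (p.1 * p.2^-1)%g).
Proof.
move=> p; apply: (@continuous_comp _ _ _ (fun p : G * G => (p.1, p.2^-1)%g)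
  (fun xy : G * G => (xy.1 * xy.2)%g)); last exact: mulg_continuous.
apply: cvg_pair => /=; first exact: cvg_fst.
apply: (@continuous_comp _ _ _ snd (fun x : G => x^-1%g)); first exact: cvg_snd.
exact: invg_continuous.
Qed.

(** This is the inclusion of B A^-1 in [V]; B A^-1 is where a coefficient of P_A u and P_B v can be
    nonzero. *)
Definition quotient_in A B V := forall x y, A x -> B y -> V (y * x^-1)%g.

Lemma nbhs_quotient_in x y V : nbhs (y * x^-1)%g V ->
  exists A B, [/\ nbhs x A, nbhs y B & quotient_in A B V].
Proof.
move=> /(@continuous_divg (y, x))[[B A] [/= yB xA] BA].
by exists A, B; split => // x' y' Ax By; exact: (BA (y', x')).
Qed.

Lemma compact_quotient A B : compact A -> compact B ->
  compact [set (p.1 * p.2^-1)%g | p in B `*` A].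
Proof.
move=> cA cB; apply: continuous_compact; last exact: compact_setX.
by apply: continuous_subspaceT; exact: continuous_divg.
Qed.

(** The support of [b] is the complement of the largest open [V] with this property. *)
Definition vanishes_on b V := forall A B, compact A -> compact B ->
  quotient_in A B V -> kills b A B.

(** Compactness is used twice. With a point of [B] fixed, finitely many local products cover [A],
    with one common neighbourhood of that point; finitely many such neighbourhoods then cover
    [B]. *)
Lemma vanishes_on_local b V : bounded_form b ->
  (forall s, V s -> exists W, [/\ open W, W s & vanishes_on b W]) ->
  vanishes_on b V.
Proof.
move=> bb locV A B cA cB AB.
(* [M] is a measurable hull, since [compact_ideal] speaks of arbitrary sets. *)
pose QB (B' : set G) := exists M : set (borel G),
  [/\ measurable M, B' `<=` M & kills b A M].
have mA : measurable (A : set (borel G)) by exact: compact_borel.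
suff [M [mM BM kM]] : QB B.
  by apply: kills_sub kM => //; exact: compact_borel.
apply: (@compact_ideal _ B QB) => //.
- exists set0; split => //; apply/killsC; apply: kills_set0; exact: bounded_formC.
- by move=> A' B' BA [M [mM AM kM]]; exists M; split => //; exact: subset_trans AM.
- move=> B1 B2 [M1 [mM1 BM1 k1]] [M2 [mM2 BM2 k2]]; exists (M1 `|` M2); split.
  + exact: measurableU.
  + exact: setUSS.
  + by apply/killsC; apply: kills_setU => //; [exact: bounded_formC|apply/killsC..].
move=> y By.
(* The neighbourhood [N] of [y] shrinks with each union taken, which is harmless as the unions are
   finite. *)
pose QA (A' : set G) := exists (M : set (borel G)) (N : set G),
  [/\ measurable M, A' `<=` M, open N, N y & kills b M N].
suff [M [N [mM AM oN Ny kM]]] : QA A.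
  exists N; first exact: open_nbhs_nbhs.
  exists N; split => //; first exact: open_borel.
  by apply: kills_sub kM => //; exact: open_borel.
apply: (@compact_ideal _ A QA) => //.
- by exists set0, setT; split => //; [exact: openT|exact: kills_set0].
- by move=> A' B' BA [M [N [mM AM ? ? kM]]]; exists M, N; split => //; exact: subset_trans AM.
- move=> A1 A2 [M1 [N1 [mM1 AM1 oN1 N1y k1]]] [M2 [N2 [mM2 AM2 oN2 N2y k2]]].
  have oN : open (N1 `&` N2) by exact: openI.
  exists (M1 `|` M2), (N1 `&` N2); split => //.
  + exact: measurableU.
  + exact: setUSS.
  + apply: kills_setU => //; first exact: open_borel.
      by apply: kills_sub k1 => //; exact: open_borel.
    by apply: kills_sub k2 => //; exact: open_borel.
move=> x Ax; have [W [oW Ws kW]] := locV _ (AB _ _ Ax By).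
have [A' [B' [xA yB AB']]] := nbhs_quotient_in (open_nbhs_nbhs (conj oW Ws)).
have [K [cK xK KA]] := compact_nbhs hG lG xA.
have [L [cL yL LB]] := compact_nbhs hG lG yB.
exists K => //; exists K, (interior L); split => //.
- exact: compact_borel.
- exact: open_interior.
have kKL : kills b K L by apply: kW => // x' y' /KA Ax' /LB; exact: AB'.
apply: kills_sub kKL; do ?[exact: compact_borel|exact: interior_subset].
  by apply: open_borel; exact: open_interior.
by [].
Qed.

Lemma vanishes_on_sigma_compact b V (A B : nat -> set G) : bounded_form b ->
  vanishes_on b V -> (forall n, compact (A n)) -> (forall n, compact (B n)) ->
  quotient_in (\bigcup_n A n) (\bigcup_n B n) V ->
  kills b (\bigcup_n A n : set (borel G)) (\bigcup_n B n).
Proof.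
move=> bb vV cA cB AB.
have mA n : measurable (A n : set (borel G)) by exact: compact_borel.
have mB n : measurable (B n : set (borel G)) by exact: compact_borel.
apply: kills_bigcup => //; first exact: bigcupT_measurable.
move=> n; apply: kills_bigcup_r => // m; apply: vV => // x y Ax By.
by apply: AB; [exists n|exists m].
Qed.

(* For T in C*_r(G) this expresses that T has no mass at the point s. *)
Definition diffuse_at b s := forall e : R, 0 < e -> exists W,
  [/\ open W, W s & forall A B : set (borel G), measurable A -> measurable B ->
    quotient_in A B W -> forall u v,
    abs1 (b (restr A u) (restr B v)) <= e * (sqn (restr A u) + sqn (restr B v))].

Lemma vanishes_on_kills b V A B A' B' : bounded_form b -> vanishes_on b V ->
  (exists2 K : nat -> set G, forall n, compact (K n) & A = \bigcup_n K n) ->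
  (exists2 K : nat -> set G, forall n, compact (K n) & B = \bigcup_n K n) ->
  quotient_in A B V ->
  measurable (A' : set (borel G)) -> measurable (B' : set (borel G)) ->
  A' `<=` A -> B' `<=` B -> kills b A' B'.
Proof.
move=> bb vV [K cK ->] [L cL ->] AB mA' mB' AA BB.
have := vanishes_on_sigma_compact bb vV cK cL AB.
apply: kills_sub => //; apply: bigcupT_measurable => n; exact: compact_borel.
Qed.

Lemma sigma_compactIl A U : compact A -> open U ->
  exists2 K : nat -> set G, forall n, compact (K n) & A `&` U = \bigcup_n K n.
Proof.
move=> cA oU; have [K cK ->] := open_sigma_compact hG lG sG oU.
exists (fun n => A `&` K n); last exact: setI_bigcupr.
by move=> n; apply: compact_closedI => //; exact: compact_closed.
Qed.

Lemma compact_sigma_compact A : compact A ->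
  exists2 K : nat -> set G, forall n, compact (K n) & A = \bigcup_n K n.
Proof. by move=> cA; exists (fun=> A) => //; rewrite bigcup_const. Qed.

(** Vanishing off [s] leaves only the graph y = s x, which is covered by small blocks U times sU. On
    each block [diffuse_at] applies, and the squared norms in its bound add up over disjoint
    blocks. *)
Lemma vanishes_on_point b s V : bounded_form b -> diffuse_at b s ->
  vanishes_on b (V `\ s) -> vanishes_on b V.
Proof.
move=> bb ds vV A B cA cB AB u v; apply: abs1_small_eq0 => e e0.
(* [M] exceeds the total of the squared norms over the blocks, so the tolerance [e / M] yields [e];
   the 1 keeps [M] positive. *)
pose M := sqn u + sqn v + 1.
have M0 : 0 < M by rewrite ltr_wpDl// addr_ge0// sqn_ge0.
have [W [oW Ws hW]] := ds (e / M) (divr_gt0 e0 M0).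
have eM0 : 0 <= e / M by rewrite ltW// divr_gt0.
(* Small neighbourhoods of any point x have this property, because (s x) x^-1 = s lies in [W]. *)
pose P U := quotient_in U [set (s * x)%g | x in U] W.
have [|||O [oO PO TO]] := @second_countable_cover G setT P sG.
- by move=> x y [].
- move=> U U' UU h x _ /UU Ux [y /UU Uy <-]; apply: h => //; by exists y.
- move=> x _; have : nbhs ((s * x) * x^-1)%g W.
    by rewrite mulgK; apply: open_nbhs_nbhs.
  move=> /nbhs_quotient_in[A' [B' [xA xB AB']]].
  exists (A' `&` [set z | B' (s * z)%g]).
    by apply: filterI => //; exact: (@continuous_mulgl G s x).
  by move=> y _ [Ay _] [z [_ Bz] <-]; exact: AB'.
(* The parts of [O n] outside [D n] are the disjoint pieces of the partition. *)
pose D n := \bigcup_(i in `I_n) O i.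
have oD n : open (D n) by apply: bigcup_open => i _; exact: oO.
have DS n : D n.+1 = D n `|` (O n `\` D n).
  rewrite {1}/D IIS bigcup_setU bigcup_set1 -/(D n).
  apply/seteqP; split => x [Dx|Ox]; [by left| |by left|by right; case: Ox].
  by have [Dx|nD] := pselect (D n x); [left|right].
pose t (U : set G) := [set y | U (s^-1 * y)%g].
have ot U : open U -> open (t U).
  by move/continuousP : (@continuous_mulgl G s^-1%g); exact.
have mO n := open_borel (oO n).
have mD n := open_borel (oD n).
have mt U : measurable (U : set (borel G)) -> measurable (t U : set (borel G)).
  by move=> mU; rewrite -[t U]setTI; exact: measurable_mulgl.
have mA := compact_borel cA; have mB := compact_borel cB.
have nk x y : (y * x^-1)%g = s -> (s^-1 * y)%g = x.
  by move=> <-; rewrite invgF mulgVK.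
(* No quotient equals [s] here: y = s x with x in [D n] would put y into [t (D n)]. The quotients
   thus stay in [V] minus [s]. *)
have kl n : kills b (A `&` D n) (B `\` t (D n)).
  apply: (vanishes_on_kills bb vV (sigma_compactIl cA (oD n))
    (compact_sigma_compact _) _ _ _ (@subset_refl _ _) (@subset_refl _ _)).
  - rewrite setDE; apply: compact_closedI => //; apply: open_closedC; exact: ot.
  - move=> x y [Ax Dx] [By Dy]; split; first exact: AB.
    by move=> /= /nk yx; apply: Dy; rewrite /t /= yx.
  - exact: measurableI.
  - by apply: measurableD => //; exact: mt.
have kr n : kills b (A `\` D n) (B `&` t (D n)).
  apply: (vanishes_on_kills bb vV (compact_sigma_compact _)
    (sigma_compactIl cB (ot _ (oD n))) _ _ _ (@subset_refl _ _) (@subset_refl _ _)).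
  - by rewrite setDE; apply: compact_closedI => //; exact: open_closedC.
  - move=> x y [Ax Dx] [By Dy]; split; first exact: AB.
    by move=> /= /nk yx; apply: Dx; move: Dy; rewrite /t /= yx.
  - exact: measurableD.
  - by apply: measurableI => //; exact: mt.
(* Induction over the pieces: each new one contributes a single diagonal block, while the cross
   terms vanish by [kl] and [kr]. *)
have diag n : abs1 (b (restr (A `&` D n) u) (restr (B `&` t (D n)) v)) <=
    e / M * (sqn (restr (A `&` D n) u) + sqn (restr (B `&` t (D n)) v)).
  elim: n => [|n IH].
    rewrite /D II0 bigcup_set0 setI0 (kills_set0 _ bb) abs1_0.
    by rewrite mulr_ge0// addr_ge0// sqn_ge0.
  have split2 (C U U' : set (borel G)) w : measurable C -> measurable U ->
      measurable U' ->
      restr (C `&` (U `|` (U' `\` U))) w =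
        restr (C `&` U) w + restr (C `&` (U' `\` U)) w :> L2 /\
      sqn (restr (C `&` (U `|` (U' `\` U))) w) =
        sqn (restr (C `&` U) w) + sqn (restr (C `&` (U' `\` U)) w).
    move=> mC mU mU'; rewrite setIUr.
    have d0 : (C `&` U) `&` (C `&` (U' `\` U)) = set0.
      by apply/seteqP; split => // x [[_ ?] [_ []]].
    by split; [rewrite restrU|rewrite sqn_restrU] => //; apply: measurableI => //;
      exact: measurableD.
  have tS : t (D n.+1) = t (D n) `|` (t (O n) `\` t (D n)) by rewrite DS.
  have [bl br _] := bb.
  rewrite tS DS.
  have [-> ->] := split2 A (D n) (O n) u mA (mD n) (mO n).
  have [-> ->] := split2 B (t (D n)) (t (O n)) v mB (mt _ (mD n)) (mt _ (mO n)).
  rewrite bl !br.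
  have mAO : measurable (A `&` (O n `\` D n) : set (borel G)).
    by apply: measurableI => //; exact: measurableD.
  have mBO : measurable (B `&` (t (O n) `\` t (D n)) : set (borel G)).
    by apply: measurableI => //; apply: measurableD; exact: mt.
  have -> : b (restr (A `&` D n) u) (restr (B `&` (t (O n) `\` t (D n))) v) = 0.
    apply: (kills_sub _ _ _ _ _ _ (kl n)) => //.
    - exact: measurableI.
    - exact: measurableI.
    - by apply: measurableD => //; exact: mt.
    - by move=> x [Bx [_ Dx]].
  have -> : b (restr (A `&` (O n `\` D n)) u) (restr (B `&` t (D n)) v) = 0.
    apply: (kills_sub _ _ _ _ _ _ (kr n)) => //.
    - exact: measurableD.
    - by apply: measurableI => //; exact: mt.
    - by apply: measurableI => //; exact: mt.
    - by move=> x [Ax [_ Dx]].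
  rewrite addr0 add0r addrACA mulrDr; apply: le_trans (abs1D _ _) _.
  apply: lerD IH _; apply: hW => // x y [_ [Ox _]] [_ [Oy _]].
  by apply: (PO n) => //; exists (s^-1 * y)%g => //; rewrite mulVKg.
have sqn_le C w : measurable (C : set (borel G)) -> sqn (restr C w) <= sqn w.
  by move=> mC; rewrite -{2}(restrT w); exact: sqn_restr_le.
(* The sets [D n] exhaust the group, so [A] may be cut down to [D n]; [kl] then cuts [B] down to
   [t (D n)]. *)
apply: (form_limit bb mA mD).
- by move=> m n mn x [i /= im Oi]; exists i => //=; exact: leq_trans mn.
- by move=> x _; have [n _ On] := TO x I; exists n.+1 => //; exists n => /=.
move=> n; have [_ br _] := bb.
rewrite (restr_split v mB (mt _ (mD n))) br (kl n) addr0.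
apply: le_trans (diag n) _.
apply: (@le_trans _ _ (e / M * M)); last by rewrite divfK ?gt_eqF.
rewrite ler_wpM2l// /M -[leLHS]addr0 lerD// lerD// sqn_le//.
  exact: measurableI.
by apply: measurableI => //; exact: mt.
Qed.

Lemma diffuse_countable_support b E : bounded_form b -> closed E -> countable E ->
  (forall s, diffuse_at b s) -> vanishes_on b (~` E) -> forall u v, b u v = 0.
Proof.
move=> bb clE cE db vE.
(* [S] is the support of [b]. *)
pose S := [set s | ~ exists W, [/\ open W, W s & vanishes_on b W]].
have vS : vanishes_on b (~` S).
  by apply: vanishes_on_local => // s /contrapT.
have SE : S `<=` E.
  move=> s nS; apply: contrapT => Es; apply: nS; exists (~` E); split => //.
  exact: closed_openC.
have clS : closed S.
  rewrite -[S]setCK; apply: open_closedC; rewrite openE => s /contrapT[W [oW Ws vW]].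
  apply: filterS (open_nbhs_nbhs (conj oW Ws)) => x Wx h.
  by apply: h; exists W.
have S0 : S = set0.
  apply: contrapT => /eqP/set0P S0.
  have cS : countable S by apply: sub_countable cE; exact: subset_card_le.
  have [s [V [oV Vs Ss VS]]] := closed_countable_isolated hG lG clS cS S0.
  (* Near [s] the support is [s] alone, so [b] vanishes on [V] minus [s], and by diffuseness on [V];
     this puts [s] outside the support. *)
  apply: Ss; exists V; split => //; apply: (vanishes_on_point bb (db s)).
  move=> A B cA cB AB; apply: vS => // x y Ax By /= Syx.
  by have [Vyx nyx] := AB x y Ax By; apply: nyx; exact: VS.
have vT : vanishes_on b setT by rewrite -setC0 -S0.
move=> u v; rewrite -(restrT u) -(restrT v).
(* The whole group is a countable union of compact sets, so vanishing on compact sets gives [b] =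
   0. *)
have [K cK KT] := open_sigma_compact hG lG sG openT.
by apply: (vanishes_on_kills bb vT (A := setT) (B := setT)) => //; exists K.
Qed.

End support.

(** * Haar measure, coefficients and the operator algebras *)

Section haar.
Context (G : topologicalGroupType) (R : realType) (mu : haarMeasure G R).
Local Notation L2 := (cL2 mu).
Local Notation restr := (@restr _ (borel G) R mu).
Local Notation "''[' u , v ]" := (L2dot u v) : ring_scope.
Implicit Types (u v w : L2) (A B K V W : set G) (T S : L2 -> L2) (s x y : G).

(** By invariance all points have the same finite mass c. If c were positive, outer regularity would
    give an open neighbourhood of the identity of mass below 2c, hence the identity alone, and
    translation would make every set open. *)
Lemma haar_set1 s : hausdorff_space G -> ~ (forall A : set G, open A) ->
  mu [set s] = 0%E.
Proof.
move=> hG nd; have mx x : measurable ([set x] : set (borel G)).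
  by apply: compact_borel => //; exact: compact_set1.
have muE x : mu [set x] = mu [set 1%g].
  rewrite -(haar_left mu x (mx 1%g)); congr (mu _).
  by rewrite image_set1 mulg1.
rewrite muE; apply: contrapT => /eqP c0.
have cfin : mu [set 1%g] \is a fin_num.
  by rewrite ge0_fin_numE//; apply: haar_compact; exact: compact_set1.
have c_gt0 : (0 < mu [set 1%g])%E by rewrite lt0e c0 measure_ge0.
have : (ereal_inf [set mu U | U in [set U : set G | open U /\ [set 1%g] `<=` U]] <
    mu [set 1%g] + mu [set 1%g])%E.
  by rewrite -haar_outer// lteDl.
move=> /ereal_inf_lt[_ [U [oU U1] <-]].
apply/negP; rewrite -leNgt.
have U1' : U 1%g by exact: U1.
have [x [Ux x1]] : exists x, U x /\ x <> 1%g.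
  apply: contrapT => h; apply: nd => A.
  have U_1 : U = [set 1%g].
    apply/seteqP; split => // x Ux; apply: contrapT => x1; apply: h.
    by exists x.
  rewrite openE => x Ax.
  have : nbhs x [set y | U (x^-1 * y)%g].
    apply: (@continuous_mulgl G x^-1%g x); rewrite mulVg.
    exact: open_nbhs_nbhs.
  apply: filterS => y /=; rewrite U_1 /= => xy.
  by rewrite -(mulVKg x y) xy mulg1.
rewrite -{2}(muE x) -measureU//.
  apply: le_measure; rewrite ?inE//; first exact: measurableU.
    exact: open_borel.
  by move=> y [->|->].
by apply/seteqP; split => // y [-> /esym].
Qed.

Lemma sqn_lambda s u : sqn (lambda s u) = sqn u.
Proof.
elim/quotW: u => f; rewrite lambdaE !sqn_pi /Rintegral; congr fine.
rewrite -[RHS](ge0_integral_mulgl mu s^-1%g (f := fun t => (csq (f t))%:E))//.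
  exact: measurable_int (csq_integrable f).
by move=> t; rewrite lee_fin csq_ge0.
Qed.

(** A nonzero integrand at t forces s^-1 t into [A] and t into [B], and then s = t (s^-1 t)^-1 lies
    in [W]. *)
Lemma coefficient_supp A B W s u v :
  measurable (A : set (borel G)) -> measurable (B : set (borel G)) ->
  quotient_in A B W -> ~ W s -> coefficient (restr A u) (restr B v) s = 0.
Proof.
move=> mA mB AB Ws; rewrite /coefficient; elim/quotW: u => f; elim/quotW: v => g.
rewrite !restrE// lambdaE L2dotE /sqdot.
rewrite [X in cintegral mu X](_ : _ = fun=> 0).
  by rewrite /cintegral /Rintegral /= !integral0.
apply/funext => t; rewrite /translate /= !cutE//.
have [tA|tA] := boolP ((s^-1 * t)%g \in A); last by rewrite mul0r.
have [tB|tB] := boolP (t \in B); last by rewrite conjc0 mulr0.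
exfalso; apply: Ws; move: (AB _ _ (set_mem tA) (set_mem tB)).
by rewrite -{1}(mulVKg s t) mulgK.
Qed.

Lemma abs1_op T (c : R) u v : opnorm_le T c ->
  abs1 '[T u, v] <= 2 * c * (Num.sqrt (sqn u) * Num.sqrt (sqn v)).
Proof.
move=> Tc; apply: le_trans (abs1_dot _ _) _.
rewrite -mulrA ler_wpM2l// mulrA ler_wpM2r ?sqrtr_ge0//; exact: Tc.
Qed.

Lemma bounded_op_form T : bounded_op T -> bounded_form (fun u v => '[T u, v]).
Proof.
move=> [lT [c Tc]]; split.
- move=> u v w; have := lT 1 u v; rewrite !scale1r => ->; exact: dotDl.
- by move=> u v w; exact: dotDr.
- by exists (2 * c) => u v; exact: abs1_op.
Qed.

Lemma abs1M (z w : R[i]) : abs1 (z * w) <= abs1 z * abs1 w.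
Proof.
case: z w => [a b] [c e]; rewrite /abs1 /=.
apply: le_trans (lerD (ler_normB _ _) (ler_normD _ _)) _; rewrite !normrM; lra.
Qed.

Lemma abs1_integrable (f : borel G -> R[i]) : f \in cLfun mu 1 ->
  mu.-integrable setT (EFin \o (fun s => abs1 (f s))).
Proof.
move=> /andP[/Lfun1_integrable fr /Lfun1_integrable fi].
have := integrableD measurableT (integrable_norm fr) (integrable_norm fi).
by [].
Qed.

(** The coefficient vanishes outside [W], so only the mass of [f] on [W] counts. One factor 2 comes
    from [abs1_dot], the other from integrating the real and imaginary parts separately. *)
Lemma integrated_form_bound f S A B W u v : f \in cLfun mu 1 ->
  integrated_form f S ->
  measurable (A : set (borel G)) -> measurable (B : set (borel G)) -> open W ->
  quotient_in A B W ->
  abs1 '[S (restr A u), restr B v] <=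
    4 * (\int[mu]_(s in W) abs1 (f s)) *
    (Num.sqrt (sqn (restr A u)) * Num.sqrt (sqn (restr B v))).
Proof.
move=> f1 [_ SE] mA mB oW AB; rewrite SE.
set u' := restr A u; set v' := restr B v; set C := Num.sqrt _ * _.
have C0 : 0 <= C by rewrite mulr_ge0// sqrtr_ge0.
have mW : measurable (W : set (borel G)) by exact: open_borel.
have iF := abs1_integrable f1.
pose h (s : borel G) : R := if s \in W then abs1 (f s) else 0.
have hE : h = (fun s => abs1 (f s)) \_ W by apply/funext => s; rewrite patchE.
have ih : mu.-integrable setT (EFin \o h).
  rewrite (_ : EFin \o h = (EFin \o (fun s => abs1 (f s))) \_ W).
    apply/(integrable_mkcond _ mW).1.
    exact: integrableS measurableT mW (@subsetT _ _) iF.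
  by apply/funext => s; rewrite /h /= patchE; case: ifP.
pose g s := 2 * C * h s.
have gE : \int[mu]_s g s = 2 * C * \int[mu]_(s in W) abs1 (f s).
  by rewrite RintegralZl// [in RHS]Rintegral_mkcond hE.
have ig : mu.-integrable setT (EFin \o g).
  rewrite [X in mu.-integrable _ X](_ : _ = (fun x => (2 * C)%:E * (h x)%:E)%E)//.
  exact: integrableZl.
have bd s : abs1 (f s * '[lambda s u', v']) <= g s.
  rewrite /g /h; have [sW|sW] := boolP (s \in W); last first.
    have -> : '[lambda s u', v'] = 0.
      by apply: (coefficient_supp u v mA mB AB) => Ws; move/negP: sW; apply; exact: mem_set.
    by rewrite !mulr0 abs1_0.
  rewrite [leRHS]mulrC; apply: le_trans (abs1M _ _) _.
  rewrite ler_wpM2l ?abs1_ge0//; apply: le_trans (abs1_dot _ _) _.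
  by rewrite sqn_lambda.
rewrite /cintegral /abs1 /=.
have -> : 4 * \int[mu]_(s in W) (abs1 (f s)) * C = \int[mu]_s g s + \int[mu]_s g s.
  by rewrite gE; ring.
apply: lerD; apply: normr_Rintegral_le => // s; apply: le_trans (bd s).
  by rewrite lerDl.
by rewrite lerDr.
Qed.

Lemma Crstar_diffuse T s : hausdorff_space G -> @second_countable G ->
  ~ (forall A : set G, open A) -> Crstar T ->
  diffuse_at (mu := mu) (fun u v => '[T u, v]) s.
Proof.
move=> hG sG nd [bT TE] e e0.
(* The errors are 2 (e/4) p q from T - S and 4 (e/8) p q from S, in total e p q, which is at most e
   (p^2 + q^2). *)
have e4 : 0 < e / 4 by rewrite divr_gt0.
have e8 : 0 < e / 8 by rewrite divr_gt0.
have [f [S [f1 fS TS]]] := TE _ e4.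
have [W [oW Ws dW WE]] := second_countable_nbhs_base hG s sG.
have mu0 : mu (\bigcap_n W n) = 0%E by rewrite WE haar_set1.
have [n hn] := integral_small_tail (abs1_integrable f1) (fun s => abs1_ge0 (f s))
  (fun n => open_borel (oW n)) dW mu0 e8.
exists (W n); split => // A B mA mB AB u v.
set p := Num.sqrt (sqn (restr A u)); set q := Num.sqrt (sqn (restr B v)).
have p0 : 0 <= p by exact: sqrtr_ge0.
have q0 : 0 <= q by exact: sqrtr_ge0.
have -> : '[T (restr A u), restr B v] =
    '[(T - S) (restr A u), restr B v] + '[S (restr A u), restr B v].
  by rewrite -dotDl /= subrK.
have b1 := abs1_op (restr A u) (restr B v) TS.
have b2 := integrated_form_bound u v f1 fS mA mB (oW n) AB.
apply: le_trans (abs1D _ _) _; apply: le_trans (lerD b1 b2) _.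
rewrite -/p -/q -(sqr_sqrtr (sqn_ge0 (restr A u))) -(sqr_sqrtr (sqn_ge0 (restr B v))).
rewrite -/p -/q; set I := Rintegral _ _ _ in hn *.
have pq : 0 <= p * q by exact: mulr_ge0.
have : 4 * I * (p * q) <= e / 2 * (p * q) by rewrite ler_wpM2r//; lra.
have : 0 <= e * (p - q) ^+ 2 by rewrite mulr_ge0 ?sqr_ge0// ltW.
have : 0 <= e * (p * q) by rewrite mulr_ge0// ltW.
rewrite sqrrB mulrDr mulrBr mulrnAr; lra.
Qed.

(** For lambda(f) the value is the integral of [f] times the coefficient; norm approximation extends
    this to [T]. *)
Lemma Crstar_coefficient0 T u v : Crstar T -> coefficient u v = (fun=> 0) ->
  '[T u, v] = 0.
Proof.
move=> [bT TE] c0; apply: abs1_small_eq0 => e e0.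
pose M := Num.sqrt (sqn u) * Num.sqrt (sqn v) + 1.
have M0 : 0 < M by rewrite ltr_wpDl// mulr_ge0// sqrtr_ge0.
have [f [S [f1 [_ SE] TS]]] := TE (e / M / 2) ltac:(by rewrite !divr_gt0).
have -> : '[T u, v] = '[(T - S) u, v] + '[S u, v] by rewrite -dotDl /= subrK.
have -> : '[S u, v] = 0.
  rewrite SE [X in cintegral mu X](_ : _ = fun=> 0).
    by rewrite /cintegral /Rintegral /= !integral0.
  apply/funext => s; have := congr1 (@^~ s) c0.
  by rewrite /coefficient /= => ->; rewrite mulr0.
rewrite addr0; apply: le_trans (abs1_op _ _ TS) _.
rewrite (_ : 2 * (e / M / 2) = e / M); last by field; rewrite gt_eqF.
rewrite mulrAC ler_pdivrMr// ler_wpM2l ?(ltW e0)//.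
by rewrite /M lerDl.
Qed.

Lemma opnorm_le0 (c : R) : 0 <= c -> opnorm_le (0 : L2 -> L2) c.
Proof.
move=> c0 u; rewrite [leLHS](_ : _ = 0) ?mulr_ge0 ?sqrtr_ge0//.
by rewrite /L2norm (dot0l (0 : L2)) sqrtr0.
Qed.

Lemma bounded_op0 : bounded_op (0 : L2 -> L2).
Proof.
split; first by move=> a u v; rewrite /= scaler0 addr0.
by exists 0; exact: opnorm_le0.
Qed.

Lemma Crstar0 : Crstar (0 : L2 -> L2).
Proof.
split; first exact: bounded_op0.
move=> e e0; exists (fun=> 0), 0; split.
- have [L0 _] := cLfun_submod_closed mu (lexx 1%E); exact: L0.
- split; first exact: bounded_op0.
  move=> u v; rewrite [RHS](_ : _ = 0); first exact: dot0l.
  rewrite [X in cintegral mu X](_ : _ = fun=> 0).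
    by rewrite /cintegral /Rintegral /= !integral0.
  by apply/funext => s; rewrite mul0r.
- by rewrite subrr; apply: opnorm_le0; exact: ltW.
Qed.

Lemma series_head (V : normedModType R) (a : nat -> V) : (forall n, a n.+1 = 0) ->
  series a @ \oo --> a 0%N.
Proof.
move=> a0; apply: cvg_near_cst; exists 1%N => // -[|n] // _.
by rewrite seriesEnat /= big_nat_recl// big1 ?addr0.
Qed.

(** Sequences vanishing after index 0 turn a single pair of vectors into a normal functional. *)
Lemma normal_functional_head (xi eta : nat -> L2) T : (forall n, eta n.+1 = 0) ->
  normal_functional xi eta T = '[T (xi 0%N), eta 0%N].
Proof.
move=> eta0; have z n : '[T (xi n.+1), eta n.+1] = 0 by rewrite eta0 dotC dot0l conjc0.
rewrite /normal_functional.
have /cvg_lim -> // := series_head (a := fun n => complex.Re '[T (xi n), eta n])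
  (fun n => congr1 (@complex.Re R) (z n)).
have /cvg_lim -> // := series_head (a := fun n => complex.Im '[T (xi n), eta n])
  (fun n => congr1 (@complex.Im R) (z n)).
Qed.

Lemma Crstar_sub_VN T : Crstar T -> VN T.
Proof.
move=> CT; split; first by case: CT.
move=> m xi eta e _ e0; exists T => // i.
rewrite subrr [X in `|X|](_ : _ = 0) ?normr0 ?ltcR//.
have z (f : nat -> R) : f = (fun=> 0) -> limn (series f) = 0.
  by move=> ->; apply: cvg_lim => //; exact: (@series_head _ (fun=> 0)).
rewrite /normal_functional !z//; apply/funext => n; rewrite dot0l //.
Qed.

(** At the single pair (u, v), [T] is approximated by operators in [Crstar], for which the value is
    0. *)
Lemma VN_coefficient0 T u v : VN T -> coefficient u v = (fun=> 0) -> '[T u, v] = 0.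
Proof.
move=> [[lT _] TE] c0; apply: abs1_small_eq0 => e e0.
pose xi (w : L2) (n : nat) : L2 := if n is 0 then w else 0.
have sx w : square_summable (xi w).
  apply: (cvgP _ (series_head (a := fun n => L2norm (xi w n) ^+ 2) _)) => n.
  by rewrite /L2norm (dot0l (0 : L2)) /= sqrtr0 expr0n.
have e2 : 0 < e / 2 by rewrite divr_gt0.
have [S CS /(_ ord0)] := TE 1%N (fun=> xi u) (fun=> xi v) (e / 2)
  (fun=> conj (sx u) (sx v)) e2.
rewrite normal_functional_head// /= dotBl (Crstar_coefficient0 CS c0) subr0.
set z := '[T u, v] => ze.
have Re_le : `|complex.Re z| <= e / 2.
  by rewrite -lecR; apply: le_trans (normc_ge_Re z) (ltW ze).
have Im_le : `|complex.Im z| <= e / 2.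
  rewrite -lecR; apply: le_trans (ltW ze); rewrite normc_def lecR.
  by rewrite -sqrtr_sqr ler_wsqrtr// lerDr sqr_ge0.
by rewrite /abs1 (splitr e) lerD.
Qed.

(** All pairings of the zero function with [VN] are 0 by [VN_coefficient0], and the zero operator
    shows that the set under the supremum is nonempty. *)
Lemma fourier_norm0 : fourier_norm mu 0 = 0.
Proof.
rewrite /fourier_norm [X in sup X](_ : _ = [set 0]) ?sup1//.
apply/seteqP; split => [r [T [z [vT _ [u [v [c0 ->]]]]]]|_ ->].
  by rewrite (VN_coefficient0 vT (esym c0)) normr0 => -[].
exists 0, 0; split.
- exact: Crstar_sub_VN Crstar0.
- exact: opnorm_le0.
- exists 0, 0; split; last by rewrite dot0l.
  by apply/funext => s; rewrite /coefficient [RHS]dotC dot0l conjc0.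
- by rewrite normr0.
Qed.

(** The coefficient of P_A u and P_B v vanishes off the compact set B A^-1, hence near [E]. It
    therefore lies in J(E), being its own approximant. *)
Lemma annihilator_vanishes_on T E : hausdorff_space G ->
  annihilator (J_ideal mu E) T ->
  vanishes_on (mu := mu) (fun u v => '[T u, v]) (~` E).
Proof.
move=> hG [vT TJ] A B cA cB AB u v.
have mA := compact_borel hG cA; have mB := compact_borel hG cB.
apply: (TJ (coefficient (restr A u) (restr B v))); last by exists (restr A u), (restr B v).
split; first by exists (restr A u), (restr B v).
move=> e e0; exists (coefficient (restr A u) (restr B v)); split.
- by exists (restr A u), (restr B v).
- pose Q : set G := [set (p.1 * p.2^-1)%g | p in B `*` A].
  have cQ : closed Q by apply: compact_closed => //; exact: compact_quotient.
  have QE : E `<=` ~` Q.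
    move=> s Es [[y x] [/= By Ax] yxs]; apply: (AB x y Ax By); by rewrite yxs.
  move=> s Es; have : nbhs s (~` Q).
    by apply: open_nbhs_nbhs; split; [exact: closed_openC|exact: QE].
  have ABQ : quotient_in A B Q by move=> x y Ax By; exists (y, x).
  by apply: filterS => t nQt; exact: (coefficient_supp u v mA mB ABQ nQt).
- by rewrite subrr fourier_norm0.
Qed.

End haar.

(** * Countable closed sets as sets of uniqueness *)

Theorem corollary4p3 (R : realType) (G : topologicalGroupType)
    (mu : haarMeasure G R) (E : set G) :
  hausdorff_space G -> locally_compact [set: G] -> @second_countable G ->
  ~ (forall A : set G, open A) ->
  closed E -> countable E -> U_set mu E.
Proof.
move=> hG lG sG nd clE cE; apply/seteqP; split => [T [aT cT]|_ ->].
  (* The form of [T] is shown to vanish everywhere, in particular at the pair (u, T u), so that T u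
     = 0. *)
  apply/funext => u; apply: dot_eq0.
  apply: (@diffuse_countable_support _ _ mu hG lG sG
    (fun u v => L2dot (T u) v) E _ clE cE).
  - by apply: bounded_op_form; case: cT.
  - by move=> s; exact: Crstar_diffuse.
  - exact: annihilator_vanishes_on.
have C0 := Crstar0 mu; split => //; split; first exact: Crstar_sub_VN.
by move=> f z _ [u [v [_ ->]]]; exact: dot0l.
Qed.
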